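(* Consider the sequence of flow-level models indexed by $r$ described in the context, operating under the weighted $\alpha$-fair bandwidth sharing policy with $\alpha\in(0,\infty)$, and satisfying the standing assumptions listed there. Assume that $$|\hat N^r(0)-\Delta(\hat W^r(0))|\to 0\quad\text{in probability as } r\to\infty .$$ Then multiplicative state space collapse holds, that is, for each $T>0$, $$\frac{\sup_{0\le t\le T}|\hat N^r(t)-\Delta(\hat W^r(t))|}{\left(\sup_{0\le t\le T}|\hat N^r(t)|\right)\vee 1}\to 0\quad\text{in probability as } r\to\infty .$$
   Context: Network. $\mathbb J$ (resources) and $\mathbb I$ (routes) are finite nonempty sets with $\mathbf J=|\mathbb J|$, $\mathbf I=|\mathbb I|$; each route is a nonempty subset of $\mathbb J$. $A$ is the $\mathbf J\times\mathbf I$ matrix with $A_{ji}=1$ if resource $j$ belongs to route $i$ and $A_{ji}=0$ otherwise; $A$ has rank $\mathbf J$. Capacities $C_j\in(0,\infty)$, $j\in\mathbb J$, weights $\kappa_i\in(0,\infty)$, $i\in\mathbb I$, and $\alpha\in(0,\infty)$ are fixed. $|\cdot|$ is the Euclidean norm. Bandwidth sharing policy. $\Lambda:\mathbb R_+^{\mathbf I}\to\mathbb R_+^{\mathbf I}$ is defined as follows: $\Lambda_i(n)=0$ if $n_i=0$; if $\mathbb I_+(n)=\{i:n_i>0\}\neq\emptyset$, then $(\Lambda_i(n))_{i\in\mathbb I_+(n)}$ is the unique maximizer of $G_n(\Lambda^+)$ over $\Lambda^+=(\Lambda_i)_{i\in\mathbb I_+(n)}$ with $\Lambda_i\ge0$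 and $\sum_{i\in\mathbb I_+(n)}A_{ji}\Lambda_i\le C_j$ for all $j\in\mathbb J$, where $G_n(\Lambda^+)=\sum_{i\in\mathbb I_+(n)}\kappa_i n_i^\alpha\frac{\Lambda_i^{1-\alpha}}{1-\alpha}$ if $\alpha\ne1$ and $G_n(\Lambda^+)=\sum_{i\in\mathbb I_+(n)}\kappa_i n_i\log\Lambda_i$ if $\alpha=1$ (the value being $-\infty$ if $\alpha\ge1$ and some $\Lambda_i=0$, $i\in\mathbb I_+(n)$). Sequence of models. $r$ runs through a sequence of positive numbers increasing to $\infty$. For each $r$ there are parameters $\nu_i^r,\mu_i^r\in(0,\infty)$, independent Poisson processes $E_i^r$ (rate $\nu_i^r$) and $S_i^r$ (rate $\mu_i^r$), $i\in\mathbb I$, and $\mathbb Z_+$-valued random variables $N_i^r(0)$; all of $E_i^r,S_i^r,N_i^r(0)$, $i\in\mathbb I$, are mutually independent. The flow count process $N^r=(N_i^r)_{i\in\mathbb I}$ satisfies $N_i^r(t)=N_i^r(0)+E_i^r(t)-S_i^r(T_i^r(t))$, where $T_i^r(t)=\int_0^t\Lambda_i(N^r(s))\,ds$. With $M^r=\mathrm{diag}(\mu^r)$, $W^r(t)=A(M^r)^{-1}N^r(t)$ is the workload process. Diffusion scaling: $\hat N^r(t)=N^r(r^2t)/r$, $\hat W^r(t)=W^r(r^2t)/r=A(M^r)^{-1}\hat N^r(t)$. Standing assumptions. (Heavy traffic) There exist $\nu,\mu\in\mathbb R_+^{\mathbf I}$ with all components strictly positive and $\theta\in\mathbb R^{\mathbf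 J}$ such that $\nu^r\to\nu$, $\mu^r\to\mu$ and $r(A\rho^r-C)\to\theta$ as $r\to\infty$, where $\rho_i^r=\nu_i^r/\mu_i^r$. Consequently $A\rho=C$, where $\rho_i=\nu_i/\mu_i$. (Initial workload) $\hat W^r(0)$ converges in distribution as $r\to\infty$ to a $\mathbf J$-dimensional random variable. Lifting map. For $w\in\mathbb R_+^{\mathbf J}$, $\Delta(w)$ is the unique minimizer of $F(n)=\frac1{\alpha+1}\sum_{i\in\mathbb I}\nu_i\kappa_i\mu_i^{\alpha-1}\left(\frac{n_i}{\nu_i}\right)^{\alpha+1}$ over $n\in\mathbb R_+^{\mathbf I}$ subject to $\sum_{i\in\mathbb I}A_{ji}\frac{n_i}{\mu_i}\ge w_j$ for all $j\in\mathbb J$. *)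

(* Defs.v *)
From HB Require Import structures.
From mathcomp Require Export all_boot all_order all_algebra.
From mathcomp Require Export all_classical all_reals all_analysis.

Set Implicit Arguments.
Unset Strict Implicit.
Unset Printing Implicit Defensive.

Export Order.TTheory GRing.Theory Num.Theory.
Export numFieldNormedType.Exports.

Global Open Scope classical_set_scope.
Global Open Scope ring_scope.

Section Probability.
Context {R : realType}.

(* The library's measures are only specified on measurable sets; every use of
   this notion is for functionals of the path of a right-continuous
   integer-valued process, for which the events below are measurable. *)
Definition cvg_to0_in_probability (d : nat -> measure_display)
    (Omega : forall k, measurableType (d k))
    (P : forall k, probability (Omega k) R) (X : forall k, Omega k -> R) :=
  forall eps : R, 0 < eps ->
    P k [set w | eps <= `|X k w|] @[k --> \oo] --> 0%E.

Definition cvg_in_distribution n (d : nat -> measure_display)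
    (Omega : forall k, measurableType (d k))
    (P : forall k, probability (Omega k) R)
    (X : forall k, Omega k -> 'cV[R]_n)
    (d' : measure_display) (Omega' : measurableType d')
    (P' : probability Omega' R) (Y : Omega' -> 'cV[R]_n) :=
  forall f : 'cV[R]_n -> R, continuous f -> (exists M, forall x, `|f x| <= M) ->
    'E_(P k)[f \o X k]%E @[k --> \oo] --> 'E_P'[f \o Y]%E.

Context {d : measure_display} {Omega : measurableType d}.
Variable P : probability Omega R.

Definition generated_sigma d' (S : measurableType d') (I : Type) (D : set I)
    (X : I -> Omega -> S) : set_system Omega :=
  <<s \bigcup_(t in D) preimage_set_system setT (X t) measurable >>.

Definition mutually_independent (K : finType) (F : K -> set_system Omega) :=
  forall (A : {set K}) (B : K -> set Omega),
    (forall k, k \in A -> F k (B k)) ->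
    fine (P (\bigcap_(k in [set` A]) B k)) = \prod_(k in A) fine (P (B k)).

Record poisson_process (rate : R) (X : R -> Omega -> nat) : Prop := {
  poisson_measurable : forall t, 0 <= t -> measurable_fun setT (X t) ;
  poisson_start : forall w, X 0 w = 0%N ;
  poisson_nondecreasing : forall w s t, 0 <= s -> s <= t -> (X s w <= X t w)%N ;
  poisson_right_continuous : forall w t, 0 <= t ->
    X s w @[s --> t^'+] --> X t w ;
  poisson_independent_increments : forall (n : nat) (t : nat -> R),
    0 <= t 0%N -> nondecreasing_seq t ->
    mutually_independent (fun m : 'I_n =>
      generated_sigma [set m]
        (fun (m : 'I_n) w => (X (t m.+1) w - X (t m) w)%N)) ;
  (* s < t is strict: [poisson_pmf 0] is not the Dirac mass at 0. *)
  poisson_increments : forall s t m, 0 <= s -> s < t ->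
    P [set w | (X t w - X s w)%N = m] = (poisson_pmf (rate * (t - s)) m)%:E
}.

End Probability.

Section Network.
Context {R : realType} {nJ nI : nat}.

Definition enorm n (v : 'cV[R]_n) : R := Num.sqrt (\sum_i v i 0 ^+ 2).

Definition incidence (route : 'I_nI -> {set 'I_nJ}) : 'M[R]_(nJ, nI) :=
  \matrix_(j, i) (j \in route i)%:R.

Definition workload (A : 'M[R]_(nJ, nI)) (mu n : 'cV[R]_nI) : 'cV[R]_nJ :=
  A *m invmx (diag_mx mu^T) *m n.

Section Policy.
Variables (A : 'M[R]_(nJ, nI)) (C : 'cV[R]_nJ) (kappa : 'cV[R]_nI) (alpha : R).

Definition policy_objective (n L : 'cV[R]_nI) : \bar R :=
  if (1 <= alpha) && [exists i, (0 < n i 0) && (L i 0 == 0)] then -oo%E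
  else (\sum_(i | (0 < n i 0)%R) kappa i 0 *
          (if alpha == 1 then n i 0 * ln (L i 0)
           else n i 0 `^ alpha * (L i 0 `^ (1 - alpha) / (1 - alpha))))%:E.

Definition policy_feasible (n L : 'cV[R]_nI) :=
  (forall i, 0 < n i 0 -> 0 <= L i 0) /\
  (forall j, \sum_(i | 0 < n i 0) A j i * L i 0 <= C j 0).

(* Only the coordinates with 0 < n i 0 enter the optimization; the other ones
   are set to 0 by the last clause. *)
Definition is_bandwidth_allocation (n L : 'cV[R]_nI) :=
  [/\ policy_feasible n L,
      forall L', policy_feasible n L' ->
        (policy_objective n L' <= policy_objective n L)%E &
      forall i, n i 0 = 0 -> L i 0 = 0].

Definition bandwidth (n : 'cV[R]_nI) : 'cV[R]_nI :=
  xget 0 [set L | is_bandwidth_allocation n L].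

End Policy.

Section Lifting.
Variables (A : 'M[R]_(nJ, nI)) (nu mu kappa : 'cV[R]_nI) (alpha : R).

Definition lifting_cost (n : 'cV[R]_nI) : R :=
  (alpha + 1)^-1 *
  \sum_i nu i 0 * kappa i 0 * mu i 0 `^ (alpha - 1) *
         (n i 0 / nu i 0) `^ (alpha + 1).

Definition lifting_feasible (w : 'cV[R]_nJ) (n : 'cV[R]_nI) :=
  (forall i, 0 <= n i 0) /\
  (forall j, w j 0 <= \sum_i A j i * (n i 0 / mu i 0)).

Definition lifting (w : 'cV[R]_nJ) : 'cV[R]_nI :=
  xget 0 [set n | lifting_feasible w n /\
    forall n', lifting_feasible w n' -> lifting_cost n <= lifting_cost n'].

End Lifting.

Section Model.
Context {d : measure_display} {Omega : measurableType d}.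
Variable P : probability Omega R.
Variables (A : 'M[R]_(nJ, nI)) (C : 'cV[R]_nJ) (kappa : 'cV[R]_nI) (alpha : R).

Definition counts (N : 'I_nI -> R -> Omega -> nat) (t : R) (w : Omega) :
  'cV[R]_nI := \col_i (N i t w)%:R.

Definition cumulative_bandwidth (N : 'I_nI -> R -> Omega -> nat)
    (i : 'I_nI) (t : R) (w : Omega) : R :=
  \int[lebesgue_measure]_(s in `[0, t])
    bandwidth A C kappa alpha (counts N s w) i 0.

Definition primitive_sigma (E S N : 'I_nI -> R -> Omega -> nat)
    (x : 'I_nI + 'I_nI + 'I_nI) : set_system Omega :=
  match x with
  | inl (inl i) => generated_sigma [set t | 0 <= t] (E i)
  | inl (inr i) => generated_sigma [set t | 0 <= t] (S i)
  | inr i => generated_sigma [set 0] (N i)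
  end.

Record flow_level_model (nu mu : 'cV[R]_nI)
    (E S N : 'I_nI -> R -> Omega -> nat) : Prop := {
  model_arrivals : forall i, poisson_process P (nu i 0) (E i) ;
  model_services : forall i, poisson_process P (mu i 0) (S i) ;
  model_measurable : forall i t, 0 <= t -> measurable_fun setT (N i t) ;
  model_independent : mutually_independent P (primitive_sigma E S N) ;
  model_dynamics : forall i t w, 0 <= t ->
    (N i t w)%:R = (N i 0 w)%:R + (E i t w)%:R
                   - (S i (cumulative_bandwidth N i t w) w)%:R :> R
}.

Definition diffusion (r : R) (N : 'I_nI -> R -> Omega -> nat)
    (t : R) (w : Omega) : 'cV[R]_nI :=
  r^-1 *: counts N (r ^+ 2 * t) w.

End Model.
End Network.

(* Main.v *)
Require Import Defs.
From mathcomp Require Import all_boot all_order all_algebra.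
From mathcomp Require Import all_classical all_reals all_analysis.
From mathcomp Require Import measurable_realfun.
From mathcomp Require Import lra ring.
Import Order.TTheory GRing.Theory Num.Theory.

(** The proof compares the path, on short windows, with a fluid path, for which
    the cost minimized by the lifting map is a Lyapunov function.

    Let [F] be that cost, [W x] the workload of the state [x] and
    [H x = F x - F (lifting (W x))] the gap of [x]. The derivative of [F] along a
    fluid path is [- \sum_i p_i (Lam_i - rho_i)], where [rho = nu / mu] are the
    balanced rates, [Lam] is the allocation and [p_i] is both a multiple of the
    derivative of [F] and the marginal utility of route [i] at [rho]. Since
    [A rho = C], the vector [rho] competes with [Lam] in the optimization that
    defines the policy, so the sum is nonnegative. It is bounded below in terms of
    [H x] ([drift_ge_gap]): if [m] is the cheapest state with the workload of
    [x], moving the rates from [rho] a little in the direction [(x - m) / mu] keeps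
    them feasible, and the resulting gain of utility is, to first order, at least
    [F x - F m] by convexity. Along a fluid path the workload does not decrease,
    because the allocation respects the capacities, so neither does
    [F (lifting (W x))]. Hence [H] decreases at a rate bounded away from zero as
    long as [H] is. The allocation is discontinuous where a coordinate
    vanishes, but there its weight [p_i] vanishes too.

    All of this survives small errors ([gap_step], [gap_stays_small]): if on each
    window of fixed hydrodynamic length the path is a fluid path up to a small
    error and [H] is small initially, then [H] stays small for ever, however
    many windows there are, since on each of them [H] either does not increase or
    visits very small values. By uniform convexity of [F], a state with small [H]
    is close to its lifting ([gap_small]).

    To reach the normalization of the theorem, divide the states by [r * M], with
    [M] the maximum of 1 and of the running supremum of the norm. The scaled path
    lies in the unit box, whatever [M] is, and a window has real length
    proportional to [r * M], at least of order [r] ([collapse_on_regular_paths]).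
    The error is small as soon as every arrival and service process has nearly its
    mean increment over each interval of a mesh of step [sigma * r]. The horizon
    [r ^+ 2 * T] contains about [r] such intervals and each fails with a
    probability exponentially small in [r] ([poisson_tail]), so a union bound gives
    a failure probability [O(1 / r)] ([collapse_probability]).

    The event of the conclusion has to be measurable. The paths turn out to be
    right-continuous with values in a countable set, so a running supremum is
    determined by the countably many events that a given state is visited
    ([running_sup_measurable]). *)

Set Implicit Arguments.
Unset Strict Implicit.
Unset Printing Implicit Defensive.

(** * Powers, exponentials and convexity *)

Section Powers.
Local Open Scope classical_set_scope.
Local Open Scope ring_scope.
Context {R : realType}.
Implicit Types a b e B x y z : R.

Lemma powR_inv x a : 0 <= x -> x^-1 `^ a = (x `^ a)^-1.
Proof. by move=> x0; rewrite -powR_inv1// -powRrM mulN1r powRN. Qed.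

(** Both values lie above the tangent of the exponential at the mean. *)
Lemma expR_convex2 (p q x y : R) : 0 <= p -> 0 <= q -> p + q = 1 ->
  expR (p * x + q * y) <= p * expR x + q * expR y.
Proof.
move=> p0 q0 pq; set m := p * x + q * y.
have tang u : expR m * (1 + (u - m)) <= expR u.
  have -> : expR u = expR m * expR (u - m) by rewrite -expRD addrC subrK.
  by rewrite ler_wpM2l ?expR_ge0 ?expR_ge1Dx.
have /(ler_wpM2l p0) hx := tang x.
have /(ler_wpM2l q0) hy := tang y.
apply: le_trans (lerD hx hy).
have -> : p * (expR m * (1 + (x - m))) + q * (expR m * (1 + (y - m))) =
  expR m * ((p + q) + (m - (p + q) * m)) by rewrite /m; ring.
by rewrite pq mul1r subrr addr0 mulr1.
Qed.

(** The three Bernoulli inequalities below are the convexity of [expR] read along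
    [x = expR (ln x)], with weights chosen so that the mean is the point at which
    the exponential is known. *)
Lemma powR_bernoulli_ge1 b x : 1 <= b -> 0 < x -> 1 + b * (x - 1) <= x `^ b.
Proof.
move=> b1 x0; have b0 : 0 < b by apply: lt_le_trans b1.
have := @expR_convex2 b^-1 (1 - b^-1) (b * ln x) 0.
rewrite subr_ge0 invr_ge0 (ltW b0) invf_le1// => /(_ isT b1).
rewrite mulrA mulVf ?gt_eqF// mul1r mulr0 addr0 lnK ?posrE// expR0 mulr1.
rewrite addrC subrK => /(_ erefl) /(ler_wpM2l (ltW b0)).
rewrite mulrDr mulrA mulfV ?gt_eqF// mul1r mulrBr mulr1 mulfV ?gt_eqF//.
rewrite /powR gt_eqF//; lra.
Qed.

Lemma powR_bernoulli_lt0 b x : b < 0 -> 0 < x -> 1 + b * (x - 1) <= x `^ b.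
Proof.
move=> b0 x0; have c0 : 0 < 1 - b by lra.
have := @expR_convex2 (- b / (1 - b)) (1 / (1 - b)) (ln x) (b * ln x).
rewrite !divr_ge0 ?(ltW c0)// ?oppr_ge0 ?(ltW b0)// => /(_ isT isT).
have -> : - b / (1 - b) + 1 / (1 - b) = 1 by field; lra.
have -> : - b / (1 - b) * ln x + 1 / (1 - b) * (b * ln x) = 0 by field; lra.
move=> /(_ erefl); rewrite expR0 lnK ?posrE// /powR gt_eqF//.
move=> /(ler_wpM2l (ltW c0)); set u := expR _.
have -> : (1 - b) * (- b / (1 - b) * x + 1 / (1 - b) * u) = - b * x + u.
  by field; lra.
lra.
Qed.

Lemma powR_bernoulli_lt1 b x : 0 < b -> b < 1 -> 0 < x ->
  x `^ b <= 1 + b * (x - 1).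
Proof.
move=> b0 b1 x0.
have := @expR_convex2 b (1 - b) (ln x) 0 (ltW b0).
rewrite subr_ge0 (ltW b1) addrC subrK => /(_ isT erefl).
rewrite mulr0 addr0 expR0 mulr1 lnK ?posrE// /powR gt_eqF//; lra.
Qed.

(** The cost of a state is a sum of such powers; this tangent inequality is the
    only form in which its convexity enters the drift estimate. *)
Lemma powR_tangent a x y : 0 < a -> 0 <= x -> 0 <= y ->
  y `^ (a + 1) - x `^ (a + 1) <= (a + 1) * y `^ a * (y - x).
Proof.
move=> a0 x0; rewrite le_eqVlt => /predU1P[<-|y0].
  rewrite !powR0 ?gt_eqF ?addr_gt0//.
  by rewrite mulr0 mul0r sub0r oppr_le0 powR_ge0.
have yS : y `^ (a + 1) = y `^ a * y.
  by rewrite powRD ?powRr1 ?(ltW y0)// (gt_eqF y0)/= implybT.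
move: x0; rewrite le_eqVlt => /predU1P[<-|x0].
  rewrite powR0 ?gt_eqF ?addr_gt0// !subr0 yS.
  have : 0 <= y `^ a * y by rewrite mulr_ge0 ?powR_ge0// ltW.
  nra.
have s0 : 0 < x / y by rewrite divr_gt0.
have b1 : 1 <= a + 1 by lra.
have := powR_bernoulli_ge1 b1 s0.
have -> : (x / y) `^ (a + 1) = x `^ (a + 1) / y `^ (a + 1).
  by rewrite powRM ?(ltW x0) ?invr_ge0 ?(ltW y0)// powR_inv// ltW.
have Y0 : 0 < y `^ a by rewrite powR_gt0.
rewrite yS ler_pdivlMr ?mulr_gt0// => h.
have e : (1 + (a + 1) * (x / y - 1)) * (y `^ a * y) =
  y `^ a * y + (a + 1) * y `^ a * (x - y) by field; lra.
rewrite e in h.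
lra.
Qed.

Definition utility a x := if a == 1 then ln x else x `^ (1 - a) / (1 - a).

(** For an exponent at least one the utility is [-oo] at the origin, a value that
    its real-valued encoding misses: hence the positivity of [x] in that case. *)
Lemma utility_tangent a x y : 0 < a -> 0 <= x -> 0 < y -> (1 <= a -> 0 < x) ->
  utility a x - utility a y <= y `^ (- a) * (x - y).
Proof.
move=> a0 x0 y0 xpos; rewrite /utility; case: eqVneq => [a1|a1].
  have {}x0 : 0 < x by apply: xpos; rewrite a1.
  rewrite a1 -ln_div ?posrE// -[X in ln X](subrK 1) addrC.
  apply: le_trans (le_ln1Dx _) _.
    by rewrite ltrBrDl subrr divr_gt0.
  rewrite powR_inv1 ?(ltW y0)//.
  by rewrite le_eqVlt; apply/orP; left; apply/eqP; field; lra.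
have Y0 : 0 < y `^ (1 - a) by rewrite powR_gt0.
have yS : y `^ (- a) = y `^ (1 - a) / y.
  rewrite addrC powRD ?powRr1 ?(ltW y0)//; last by rewrite (gt_eqF y0) implybT.
  by rewrite mulfK ?gt_eqF.
move: x0; rewrite le_eqVlt => /predU1P[x0|x0].
  have a_lt1 : a < 1.
    by rewrite ltNge; apply/negP => /xpos; rewrite x0 ltxx.
  rewrite -x0 powR0; last by rewrite subr_eq0 eq_sym.
  rewrite mul0r !sub0r mulrN lerN2 yS mulfVK ?gt_eqF//.
  rewrite ler_pdivlMr; last by lra.
  by nra.
have s0 : 0 < x / y by rewrite divr_gt0.
have sE : x `^ (1 - a) = (x / y) `^ (1 - a) * y `^ (1 - a).
  by rewrite -powRM ?(ltW s0) ?(ltW y0)// divfK ?gt_eqF.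
rewrite sE yS.
have -> : y `^ (1 - a) / y * (x - y) = y `^ (1 - a) * (x / y - 1).
  by field; lra.
rewrite -mulrBl -[X in _ * _ - X]mul1r -mulrBl mulrAC mulrC ler_pM2l//.
have [alt1|agt1] := ltP a 1.
  rewrite ler_pdivrMr ?subr_gt0//.
  have := @powR_bernoulli_lt1 (1 - a) _ _ _ s0; lra.
have {}agt1 : 1 < a by lra.
rewrite ler_ndivrMr ?subr_lt0//.
have := @powR_bernoulli_lt0 (1 - a) _ _ s0; lra.
Qed.

Lemma continuous_powR_pos a x : 0 < x -> {for x, continuous (fun z => z `^ a)}.
Proof.
move=> x0; apply: differentiable_continuous.
by have [/derivable1_diffP] := is_derive1_powR a x0.
Qed.

Lemma continuous_max_cst (c : R) : continuous (fun x => Num.max x c).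
Proof.
move=> x; apply: continuous_max; by [exact: cvg_id | exact: cvg_cst].
Qed.

(** Truncation removes the junk value 1 of a power at negative numbers, so that
    continuity holds on the whole line and the extreme value theorem applies. *)
Lemma continuous_powR_max0 a : 0 < a -> continuous (fun x => Num.max x 0 `^ a).
Proof.
move=> a0 x; have [x0|x0] := ltP 0 x.
  apply: (@continuous_comp _ _ _ (fun x => Num.max x 0) (fun z => z `^ a)).
    exact: continuous_max_cst.
  by apply: continuous_powR_pos; rewrite lt_max x0.
apply/cvgrPdist_lt => e e0.
rewrite (max_idPr x0) powR0 ?gt_eqF//.
have d0 : 0 < e `^ a^-1 by rewrite powR_gt0.
near=> y; rewrite sub0r normrN ger0_norm ?powR_ge0//.
have -> : e = (e `^ a^-1) `^ a.
  by rewrite -powRrM mulVf ?powRr1 ?(ltW e0)// gt_eqF.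
apply: gt0_ltr_powR => //; rewrite ?nnegrE ?(ltW d0)// ?le_max ?lexx ?orbT//.
rewrite gt_max d0 andbT.
have : `|x - y| < e `^ a^-1.
  by near: y; exists (e `^ a^-1).
by rewrite ltr_norml => /andP[]; lra.
Unshelve. all: by end_near.
Qed.

(** The increment over a step [e] is positive and continuous in [z], so it has a
    positive minimum over a bounded interval. *)
Lemma powR_gap a e B : 0 < a -> 0 < e -> 0 <= B ->
  exists2 d, 0 < d & forall z, 0 <= z -> z <= B -> d <= (z + e) `^ a - z `^ a.
Proof.
move=> a0 e0 B0.
pose g z := Num.max (z + e) 0 `^ a - Num.max z 0 `^ a.
have gc : continuous g.
  move=> z; apply: cvgB; last exact: continuous_powR_max0.
  apply: (@continuous_comp _ _ _ (fun z => z + e)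
    (fun x => Num.max x 0 `^ a)); last exact: continuous_powR_max0.
  by apply: cvgD; [exact: cvg_id | exact: cvg_cst].
have [c cB cmin] := @EVT_min R g 0 B B0 (continuous_subspaceT gc).
have /andP[c0 _] : 0 <= c <= B by move: cB; rewrite in_itv.
exists (g c) => [|z z0 zB].
  rewrite subr_gt0 !(max_idPl _) ?addr_ge0 ?(ltW e0)//.
  by apply: gt0_ltr_powR; rewrite // ?nnegrE ?addr_ge0 ?(ltW e0)//; lra.
have := cmin z; rewrite in_itv/= z0 zB => /(_ isT).
by rewrite {2}/g !(max_idPl _) ?addr_ge0 ?(ltW e0).
Qed.

(** Uniform continuity of a power on a bounded interval is the uniform strict
    monotonicity of the inverse power. *)
Lemma powR_modulus a e B : 0 < a -> 0 < e -> 0 <= B ->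
  exists2 d, 0 < d & forall x y, 0 <= x -> x <= B -> 0 <= y -> y <= B ->
    `|x - y| < d -> `|x `^ a - y `^ a| <= e.
Proof.
move=> a0 e0 B0; have ia0 : 0 < a^-1 by rewrite invr_gt0.
have [d d0 gap] := powR_gap ia0 e0 (powR_ge0 B a).
have aK x : 0 <= x -> (x `^ a) `^ a^-1 = x.
  by move=> x0; rewrite -powRrM mulfV ?gt_eqF// powRr1.
exists d => // x y.
wlog xy : x y / x <= y => [hw x0 xB y0 yB|].
  have [/hw|/ltW/hw] := leP x y; first exact.
  by move=> H *; rewrite distrC; apply: H => //; rewrite distrC.
move=> x0 xB y0 yB; rewrite !ler0_norm ?subr_le0//; last first.
  by apply: ge0_ler_powR; rewrite ?nnegrE ?(ltW a0).
rewrite !opprB => yx; rewrite leNgt; apply/negP => exy.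
have := gap (x `^ a) (powR_ge0 _ _); rewrite aK//.
have -> : x `^ a <= B `^ a by apply: ge0_ler_powR; rewrite ?nnegrE ?(ltW a0).
move=> /(_ isT); apply/negP; rewrite -ltNge.
suff : (x `^ a + e) `^ a^-1 <= y by lra.
rewrite -[leRHS]aK//; apply: ge0_ler_powR; rewrite ?nnegrE ?powR_ge0//;
  rewrite ?(ltW ia0)// ?addr_ge0 ?powR_ge0 ?(ltW e0)//; lra.
Qed.

(** Uniform convexity on bounded intervals: tangents at the midpoint and half-way
    between it and the larger point leave the gain of slope from one to the other. *)
Lemma powR_midpoint a e B : 0 < a -> 0 < e -> 0 <= B ->
  exists2 s, 0 < s & forall x y, 0 <= x -> x <= B -> 0 <= y -> y <= B ->
    e <= `|x - y| ->
    ((x + y) / 2) `^ (a + 1) + s <= (x `^ (a + 1) + y `^ (a + 1)) / 2.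
Proof.
move=> a0 e0 B0; have e40 : 0 < e / 4 by lra.
have [d d0 gap] := powR_gap a0 e40 B0.
exists ((a + 1) * (e / 8) * d) => [|x y].
  by rewrite !mulr_gt0//; lra.
wlog xy : x y / x <= y => [hw x0 xB y0 yB|].
  have [/hw|/ltW/hw] := leP x y; first exact.
  by move=> H *; rewrite [x + y]addrC [X in _ <= X / 2]addrC; apply: H => //;
    rewrite distrC.
move=> x0 xB y0 yB; rewrite ler0_norm ?subr_le0// opprB => exy.
pose z := (x + y) / 2; pose h := (y - x) / 2.
have z0 : 0 <= z by rewrite /z; lra.
have zB : z <= B by rewrite /z; lra.
have h0 : e / 2 <= h by rewrite /h; lra.
have t1 := powR_tangent a0 y0 (_ : 0 <= z + h / 2).
have t2 := powR_tangent a0 (_ : 0 <= z + h / 2) z0.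
have t3 := powR_tangent a0 x0 z0.
have zh : 0 <= z + h / 2 by lra.
move: (t1 zh) (t2 zh) t3 => {}t1 {}t2 t3.
have g := gap z z0 zB.
have m : (z + e / 4) `^ a <= (z + h / 2) `^ a.
  by apply: ge0_ler_powR; rewrite ?nnegrE ?(ltW a0)//; lra.
rewrite -/z.
have ez1 : z + h / 2 - y = - (h / 2) by rewrite /z /h; field.
have ez2 : z - (z + h / 2) = - (h / 2) by ring.
have ez3 : z - x = h by rewrite /z /h; field.
rewrite ez1 in t1; rewrite ez2 in t2; rewrite ez3 in t3.
have k : (a + 1) * (e / 4) * d <= (a + 1) * (h / 2) *
    ((z + h / 2) `^ a - z `^ a).
  apply: ler_pM; [by apply: mulr_ge0; lra|lra|by apply: ler_wpM2l; lra|lra].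
move: k t1 t2 t3; lra.
Qed.

Lemma powR_lipschitz a B x y : 0 < a -> 0 <= x -> x <= B -> 0 <= y -> y <= B ->
  x `^ (a + 1) - y `^ (a + 1) <= (a + 1) * B `^ a * `|x - y|.
Proof.
move=> a0 x0 xB y0 yB; apply: le_trans (powR_tangent a0 y0 x0) _.
apply: (@le_trans _ _ ((a + 1) * x `^ a * `|x - y|)).
  by rewrite ler_wpM2l ?ler_norm// mulr_ge0 ?powR_ge0//; lra.
rewrite ler_wpM2r// ler_wpM2l//; first lra.
by apply: ge0_ler_powR; rewrite ?nnegrE ?(ltW a0)//; lra.
Qed.

End Powers.

(** * Maximizing a separable function over a polytope *)

Section SeparableMaximum.
Context {R : realType}.
Local Open Scope classical_set_scope.
Local Open Scope ring_scope.

(** Serves both optimization problems: the allocation maximizes, and the lifting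
    map minimizes, a separable function over a polytope inside a box. *)
Lemma separable_max (m n : nat) (a : 'M[R]_(m, n)) (b : 'cV[R]_m) (B : R)
    (g : 'I_n -> R -> R)
    (D := [set x : 'cV[R]_n | (forall i, 0 <= x i 0 <= B) /\
            forall j, \sum_i a j i * x i 0 <= b j 0]) :
  (forall i, continuous (g i)) -> D !=set0 ->
  exists2 x, D x & forall y, D y -> \sum_i g i (y i 0) <= \sum_i g i (x i 0).
Proof.
move=> gc [x0 Dx0].
pose K := [set v : 'rV[R]_n | forall i, `[0, B]%classic (v 0 i)] `&`
  \bigcap_(j in [set: 'I_m]) [set v : 'rV[R]_n | \sum_i a j i * v 0 i <= b j 0].
have cc (h : 'I_n -> R -> R) : (forall i, continuous (h i)) ->
    continuous (fun v : 'rV[R]_n => \sum_i h i (v 0 i)).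
  move=> hc v; apply: (@cvg_big _ _ _ _ _ add_continuous _ (nbhs v)) => i _.
  apply: (@continuous_comp _ _ _ (fun v : 'rV[R]_n => v 0 i) (h i)).
    exact: coord_continuous.
  exact: hc.
have cK : compact K.
  apply: compact_closedI.
    by apply: (@rV_compact R n (fun _ => `[0, B]%classic)) => i; exact: segment_compact.
  apply: closed_bigI => j _.
  have /continuous_closedP/(_ [set x | x <= b j 0]) :=
    cc (fun i x => a j i * x) (fun i => @mulrl_continuous R (a j i)).
  by apply; exact: closed_le.
have K0 : K !=set0.
  exists x0^T; split=> [i|j _] /=; first by rewrite in_itv/= mxE; exact: Dx0.1.
  by under eq_bigr do rewrite mxE; exact: Dx0.2.
have [c /set_mem [cB cb] cmax] :=
  compact_EVT_max K0 cK (continuous_subspaceT (cc g gc)).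
exists c^T => [|y [yB yb]].
  split=> [i|j]; first by rewrite mxE; have := cB i; rewrite /= in_itv.
  by under eq_bigr do rewrite mxE; exact: cb.
have yK : y^T \in K.
  apply/mem_set; split=> [i|j _] /=; first by rewrite in_itv/= mxE.
  by under eq_bigr do rewrite mxE; exact: yb.
have := cmax _ yK.
under eq_bigr do rewrite mxE.
by have -> : \sum_i g i (c^T i 0) = \sum_i g i (c 0 i)
  by apply: eq_bigr => i _; rewrite mxE.
Qed.

End SeparableMaximum.

(** * The bandwidth sharing policy *)

Section Utility.
Context {R : realType}.
Local Open Scope classical_set_scope.
Local Open Scope ring_scope.
Implicit Types a x y Y : R.

Lemma utility_le a x y : 0 < a -> 0 <= x -> (1 <= a -> 0 < x) -> x <= y ->
  utility a x <= utility a y.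
Proof.
move=> a0 x0 xpos xy; have [y0|y0] := ltP 0 y; last first.
  by have -> : x = y by lra.
rewrite -subr_le0; apply: le_trans (utility_tangent a0 x0 y0 xpos) _.
by rewrite mulr_ge0_le0 ?powR_ge0// subr_le0.
Qed.

(** Truncating the argument from below at [d] makes the utility continuous; the
    free level [Y] lets the truncated value be as low as desired when the utility
    is unbounded below. *)
Lemma utility_floor a Y : 0 < a -> 0 <= Y -> exists d,
  [/\ 0 <= d <= 1, continuous (fun x => utility a (Num.max x d)),
      1 <= a -> 0 < d /\ utility a d <= - Y & a < 1 -> d = 0].
Proof.
move=> a0 Y0; have [a1|a1] : a < 1 \/ 1 <= a by case: ltP; [left | right].
  exists 0; split=> //; first by rewrite lexx ler01.
    rewrite /utility lt_eqF// => x; apply: cvgM; last exact: cvg_cst.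
    by apply: continuous_powR_max0; rewrite subr_gt0.
  by move=> /(lt_le_trans a1); rewrite ltxx.
exists (expR (- Y)); split.
- by rewrite expR_ge0 -expR0 ler_expR oppr_le0.
- move=> x.
  apply: (@continuous_comp _ _ _ (fun x => Num.max x (expR (- Y))) (utility a)).
    exact: continuous_max_cst.
  have m0 : 0 < Num.max x (expR (- Y)) by rewrite lt_max expR_gt0 orbT.
  rewrite /utility; case: eqP => _; first exact: continuous_ln.
  by apply: cvgM; [exact: continuous_powR_pos | exact: cvg_cst].
- move=> _; rewrite expR_gt0 /utility; split=> //; case: eqVneq => [_|ne].
    by rewrite expRK.
  have {ne}a1 : 1 < a by lra.
  rewrite -expRM ler_ndivrMr ?subr_lt0//.
  have := expR_ge1Dx (- Y * (1 - a)); lra.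
by rewrite ltNge a1.
Qed.

End Utility.


Section Bandwidth.
Context {R : realType} {nJ nI : nat}.
Local Open Scope classical_set_scope.
Local Open Scope ring_scope.
Context (A : 'M[R]_(nJ, nI)) (C : 'cV[R]_nJ) (rho kappa : 'cV[R]_nI) (alpha : R).
Context (A01 : forall j i, A j i = 0 \/ A j i = 1).
Context (Acol : forall i, exists j, A j i = 1).
Context (rho_gt0 : forall i, 0 < rho i 0).
Context (Arho : forall j, \sum_i A j i * rho i 0 = C j 0).
Context (kappa_gt0 : forall i, 0 < kappa i 0) (alpha_gt0 : 0 < alpha).

Lemma incidence_ge0 j i : 0 <= A j i.
Proof. by case: (A01 j i) => ->. Qed.

Lemma capacity_ge0 j : 0 <= C j 0.
Proof.
rewrite -Arho sumr_ge0// => i _.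
by rewrite mulr_ge0 ?incidence_ge0// ltW.
Qed.

(** Every route uses some resource, so a feasible rate is at most a capacity. *)
Lemma feasible_le (P : pred 'I_nI) (L : 'cV[R]_nI) i :
  (forall i, P i -> 0 <= L i 0) ->
  (forall j, \sum_(i | P i) A j i * L i 0 <= C j 0) ->
  P i -> L i 0 <= \sum_j C j 0.
Proof.
move=> L0 LC Pi; have [j Aji] := Acol i.
apply: (@le_trans _ _ (C j 0)).
  apply: le_trans (LC j); rewrite (bigD1 i)//= Aji mul1r lerDl.
  by rewrite sumr_ge0// => k /andP[Pk _]; rewrite mulr_ge0 ?incidence_ge0 ?L0.
by rewrite (bigD1 j)//= lerDl sumr_ge0// => k _; exact: capacity_ge0.
Qed.

Context (n : 'cV[R]_nI).
Context (n_ge0 : forall i, 0 <= n i 0).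

Let wt i := kappa i 0 * n i 0 `^ alpha.

Lemma policy_objectiveE (L : 'cV[R]_nI) :
  (1 <= alpha -> forall i, 0 < n i 0 -> L i 0 != 0) ->
  policy_objective kappa alpha n L =
  (\sum_(i | 0 < n i 0) wt i * utility alpha (L i 0))%:E.
Proof.
move=> Lne0; rewrite /policy_objective ifF; last first.
  apply/negbTE/negP => /andP[a1 /existsP[i /andP[ni /eqP Li]]].
  by have := Lne0 a1 i ni; rewrite Li eqxx.
congr EFin; apply: eq_bigr => i _; rewrite /wt /utility -mulrA; congr (_ * _).
by case: eqP => // ->; rewrite powRr1.
Qed.

(** The objective is [-oo] on part of the boundary, so it is replaced by its
    truncation at a level [d] chosen so low that no maximizer of the truncated
    objective goes below it; on such a maximizer both objectives agree. *)
Lemma bandwidth_exists : exists L, is_bandwidth_allocation A C kappa alpha n L.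
Proof.
pose c := \sum_j C j 0.
have c0 : 0 <= c by rewrite sumr_ge0// => j _; exact: capacity_ge0.
pose u := utility alpha.
have wt_gt0 i : 0 < n i 0 -> 0 < wt i.
  by move=> ni; rewrite mulr_gt0 ?powR_gt0.
pose G := \sum_(i | 0 < n i 0) wt i * (u (c + 1) - u (rho i 0)).
have rhoc i : rho i 0 <= c.
  apply: (@feasible_le xpredT) => // [k _|j]; first exact: ltW.
  by rewrite Arho.
have uc x : 0 < x -> x <= c + 1 -> u x <= u (c + 1).
  by move=> x0 xc; apply: utility_le => //; exact: ltW.
have G0 : 0 <= G.
  apply: sumr_ge0 => i ni; rewrite mulr_ge0 ?(ltW (wt_gt0 _ ni))// subr_ge0.
  by apply: uc => //; have := rhoc i; lra.
pose Y := `|u (c + 1)| + \sum_(i | 0 < n i 0) G / wt i + 1.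
have S0 : 0 <= \sum_(i | 0 < n i 0) G / wt i.
  by apply: sumr_ge0 => i /wt_gt0 wi; rewrite divr_ge0 ?(ltW wi).
have Y0 : 0 <= Y by rewrite /Y !addr_ge0.
have [d [/andP[d0 d1] dcont dpos dzero]] := utility_floor alpha_gt0 Y0.
pose g i x := if 0 < n i 0 then wt i * u (Num.max x d) else 0.
have gc i : continuous (g i).
  rewrite /g; case: (0 < n i 0) => x; last exact: cvg_cst.
  by apply: cvgM; [exact: cvg_cst | exact: dcont].
have D0 : [set x : 'cV[R]_nI | (forall i, 0 <= x i 0 <= c) /\
    forall j, \sum_i A j i * x i 0 <= C j 0] rho.
  by split=> [i|j]; rewrite ?Arho// (ltW (rho_gt0 i)) rhoc.
have [L [Lc LC] Lmax] := separable_max gc (ex_intro _ _ D0).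
have L_ge0 i : 0 <= L i 0 by have /andP[] := Lc i.
have sumg (x : 'cV[R]_nI) : \sum_i g i (x i 0) =
    \sum_(i | 0 < n i 0) wt i * u (Num.max (x i 0) d).
  by symmetry; exact: big_mkcond.
(* below the floor [d], a single coordinate would already cost more than the
   whole margin [G] that separates [rho] from the constant bound [c + 1] *)
have Ld i : 1 <= alpha -> 0 < n i 0 -> d <= L i 0.
  move=> a1 ni; rewrite leNgt; apply/negP => Lid; have [dp ud] := dpos a1.
  have := Lmax _ D0; rewrite !sumg leNgt => /negP; apply.
  have le1 : wt i * (u (c + 1) - u d) <=
      \sum_(i | 0 < n i 0) wt i * (u (c + 1) - u (Num.max (L i 0) d)).
    rewrite [leRHS](bigD1 i)//= (max_idPr (ltW Lid)) lerDl sumr_ge0// => k.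
    move=> /andP[nk _]; rewrite mulr_ge0 ?(ltW (wt_gt0 _ nk))// subr_ge0 uc//.
      by rewrite lt_max dp orbT.
    have /andP[_ Lk] := Lc k; rewrite ge_max; apply/andP; split; lra.
  have le2 : G < wt i * (u (c + 1) - u d).
    rewrite mulrC -ltr_pdivrMr ?wt_gt0//.
    have : G / wt i <= \sum_(i | 0 < n i 0) G / wt i.
      rewrite [leRHS](bigD1 i)//= lerDl sumr_ge0// => k /andP[/wt_gt0 wk _].
      by rewrite divr_ge0 ?(ltW wk).
    have : - `|u (c + 1)| <= u (c + 1) by rewrite lerNl -normrN ler_norm.
    move: ud; rewrite /Y -/u; lra.
  have le3 : \sum_(i | 0 < n i 0) wt i * u (rho i 0) <=
      \sum_(i | 0 < n i 0) wt i * u (Num.max (rho i 0) d).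
    apply: ler_sum => k nk; rewrite ler_wpM2l ?(ltW (wt_gt0 _ nk))//.
    by apply: utility_le; rewrite ?le_max ?lexx// ltW.
  apply: lt_le_trans le3; move: (lt_le_trans le2 le1); rewrite /G.
  under [X in X < _]eq_bigr do rewrite mulrBr.
  under [X in _ < X]eq_bigr do rewrite mulrBr.
  by rewrite !sumrB ltrD2l ltrN2.
have Lmaxd i : 0 < n i 0 -> Num.max (L i 0) d = L i 0.
  move=> ni; apply/max_idPl; have [a1|a1] := ltP alpha 1; first by rewrite dzero.
  exact: Ld.
exists (\col_i if 0 < n i 0 then L i 0 else 0); split.
- split=> [i ni|j]; first by rewrite mxE ni.
  apply: le_trans (LC j); rewrite big_mkcond/=; apply: ler_sum => i _.
  by rewrite mxE; case: (0 < n i 0) => //; rewrite mulr_ge0 ?incidence_ge0.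
- move=> L' [L'0 L'C].
  rewrite [leRHS]policy_objectiveE; last first.
    move=> a1 i ni; rewrite mxE ni gt_eqF//.
    by apply: lt_le_trans (Ld _ a1 ni); have [] := dpos a1.
  have [bad|/negbTE good] := boolP ((1 <= alpha) &&
      [exists i, (0 < n i 0) && (L' i 0 == 0)]).
    by rewrite /policy_objective bad leNye.
  have L'pos : 1 <= alpha -> forall i, 0 < n i 0 -> L' i 0 != 0.
    move=> a1 i ni; apply/negP => Li0; move/negP: good; apply.
    by rewrite a1; apply/existsP; exists i; rewrite ni.
  rewrite policy_objectiveE// lee_fin.
  pose L'' : 'cV[R]_nI := \col_i if 0 < n i 0 then L' i 0 else 0.
  have /Lmax : (forall i, 0 <= L'' i 0 <= c) /\
      forall j, \sum_i A j i * L'' i 0 <= C j 0.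
    split=> [i|j].
      rewrite mxE; case: ifP => ni; last by rewrite lexx.
      by rewrite L'0//=; exact: (@feasible_le (fun i => 0 < n i 0)).
    apply: le_trans (L'C j); rewrite [leRHS]big_mkcond/=; apply: ler_sum => i _.
    by rewrite mxE; case: ifP => // _; rewrite mulr0.
  rewrite !sumg => /le_trans le2.
  apply: (@le_trans _ _ (\sum_(i | 0 < n i 0) wt i * u (Num.max (L'' i 0) d))).
    apply: ler_sum => i ni; rewrite ler_wpM2l ?(ltW (wt_gt0 _ ni))//.
    rewrite mxE ni; apply: utility_le; rewrite ?le_max ?lexx ?L'0// => a1.
    by rewrite lt_neqAle eq_sym L'pos//= L'0.
  apply: le2; apply: ler_sum => i ni.
  by rewrite mxE ni Lmaxd.
- by move=> i ni; rewrite mxE ni ltxx.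
Qed.

Lemma bandwidthP :
  is_bandwidth_allocation A C kappa alpha n (bandwidth A C kappa alpha n).
Proof. exact: (xgetPex 0 bandwidth_exists). Qed.

Let Lam := bandwidth A C kappa alpha n.

Lemma bandwidth_ge0 i : 0 <= Lam i 0.
Proof.
have [[L0 _] _ Lz] := bandwidthP; have [ni|ni] := ltP 0 (n i 0).
  exact: L0.
by rewrite /Lam Lz//; have := n_ge0 i; lra.
Qed.

Lemma bandwidth_capacity j : \sum_i A j i * Lam i 0 <= C j 0.
Proof.
have [[_ LC] _ Lz] := bandwidthP; apply: le_trans (LC j).
rewrite [leRHS]big_mkcond/=; apply: ler_sum => i _; case: ifPn => // ni.
by rewrite /Lam Lz ?mulr0//; have := n_ge0 i; move: ni; rewrite -leNgt; lra.
Qed.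

Lemma bandwidth_le i : Lam i 0 <= \sum_j C j 0.
Proof.
apply: (@feasible_le xpredT) => // [k _|j]; first exact: bandwidth_ge0.
exact: bandwidth_capacity.
Qed.

(** The heart of the drift estimate. Two tangent inequalities sandwich the optimal
    value: concavity at [rho] bounds [G Lam - G rho] by the right-hand side, and
    concavity at [L] bounds [G rho - G L] by minus the left-hand side, while
    [G L <= G Lam] by optimality. The weight [n i 0 `^ alpha] kills the
    coordinates at which the allocation is discontinuous. *)
Lemma bandwidth_drift (L : 'cV[R]_nI) : (forall i, 0 < L i 0) ->
  (forall j, \sum_i A j i * L i 0 <= C j 0) ->
  \sum_i wt i * L i 0 `^ (- alpha) * (L i 0 - rho i 0) <=
  \sum_i wt i * rho i 0 `^ (- alpha) * (Lam i 0 - rho i 0).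
Proof.
move=> L0 LC; have [[_ _] Lopt _] := bandwidthP.
have [bad|/negbTE good] := boolP ((1 <= alpha) &&
      [exists i, (0 < n i 0) && (Lam i 0 == 0)]).
  have /Lopt : policy_feasible A C n L.
    split=> [i _|j]; first exact: ltW.
    apply: le_trans (LC j); rewrite big_mkcond/=; apply: ler_sum => i _.
    by case: ifP => // _; rewrite mulr_ge0 ?incidence_ge0// ltW.
  rewrite [leLHS]policy_objectiveE; last by move=> _ i _; rewrite gt_eqF.
  by rewrite /policy_objective -/Lam bad leeNy_eq.
have Lpos : 1 <= alpha -> forall i, 0 < n i 0 -> Lam i 0 != 0.
  move=> a1 i ni; apply/negP => Li0; move/negP: good; apply.
  by rewrite a1; apply/existsP; exists i; rewrite ni.
have /Lopt : policy_feasible A C n L.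
  split=> [i _|j]; first exact: ltW.
  apply: le_trans (LC j); rewrite big_mkcond/=; apply: ler_sum => i _.
  by case: ifP => // _; rewrite mulr_ge0 ?incidence_ge0// ltW.
rewrite !policy_objectiveE//; last by move=> _ i _; rewrite gt_eqF.
rewrite lee_fin => opt.
have wt_ge0 i : 0 <= wt i by rewrite mulr_ge0 ?powR_ge0// ltW.
have wt0 i : ~~ (0 < n i 0) -> wt i = 0.
  move=> ni; rewrite /wt; have -> : n i 0 = 0 by have := n_ge0 i; move: ni; rewrite -leNgt; lra.
  by rewrite powR0 ?mulr0// gt_eqF.
have supp (f : 'I_nI -> R) :
    \sum_i wt i * f i = \sum_(i | 0 < n i 0) wt i * f i.
  rewrite [RHS]big_mkcond; apply: eq_bigr => i _; case: ifPn => // /wt0 ->.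
  by rewrite mul0r.
under eq_bigr do rewrite -mulrA.
under [leRHS]eq_bigr do rewrite -mulrA.
rewrite !supp.
have h i : 0 < n i 0 -> wt i * utility alpha (Lam i 0) - wt i * utility alpha (L i 0)
  <= wt i * (rho i 0 `^ (- alpha) * (Lam i 0 - rho i 0)) -
     wt i * (L i 0 `^ (- alpha) * (L i 0 - rho i 0)).
  move=> ni; rewrite -!mulrBr ler_wpM2l//.
  have Lp : 1 <= alpha -> 0 < Lam i 0.
    by move=> a1; rewrite lt_neqAle eq_sym Lpos//= bandwidth_ge0.
  have := utility_tangent alpha_gt0 (bandwidth_ge0 i) (rho_gt0 i) Lp.
  rewrite -/Lam.
  have := @utility_tangent R alpha (rho i 0) (L i 0) alpha_gt0
    (ltW (rho_gt0 i)) (L0 i) (fun=> rho_gt0 i).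
  lra.
rewrite -subr_ge0 -sumrB; apply: le_trans (ler_sum _ h).
by rewrite sumrB subr_ge0.
Qed.

End Bandwidth.

(** * The lifting map and the gap of a state *)

Section Preliminaries.
Context {R : realType}.
Local Open Scope classical_set_scope.
Local Open Scope ring_scope.

Lemma finite_lower_bound n (d : 'I_n -> R) : (forall i, 0 < d i) ->
  exists2 e, 0 < e & forall i, e <= d i.
Proof.
move=> d0; have s0 : 0 <= \sum_i (d i)^-1.
  by apply: sumr_ge0 => i _; rewrite invr_ge0 ltW.
exists (1 + \sum_i (d i)^-1)^-1 => [|i]; first by rewrite invr_gt0; lra.
rewrite -[leRHS]invrK lef_pV2 ?posrE ?invr_gt0//; last lra.
rewrite (bigD1 i)//=; set s := (X in _ <= 1 + (_ + X)).
have : 0 <= s by apply: sumr_ge0 => k _; rewrite invr_ge0 ltW.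
lra.
Qed.

Lemma sum_ge_term n (f : 'I_n -> R) i : (forall i, 0 <= f i) ->
  f i <= \sum_i f i.
Proof. by move=> f0; rewrite (bigD1 i)//= lerDl sumr_ge0. Qed.

Lemma powR_le1 (a x : R) : 0 < a -> 0 <= x -> x <= 1 -> x `^ a <= 1.
Proof.
move=> a0 x0 x1; have -> : 1 = 1 `^ a :> R by rewrite powR1.
by apply: ge0_ler_powR; rewrite ?nnegrE// ltW.
Qed.

Lemma powR_midpoint_le (a x y : R) : 0 < a -> 0 <= x -> 0 <= y ->
  ((x + y) / 2) `^ (a + 1) <= (x `^ (a + 1) + y `^ (a + 1)) / 2.
Proof.
move=> a0 x0 y0; have m0 : 0 <= (x + y) / 2 by lra.
have := powR_tangent a0 x0 m0; have := powR_tangent a0 y0 m0.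
have -> : (x + y) / 2 - y = - ((x + y) / 2 - x) by field.
lra.
Qed.

End Preliminaries.

Section Lifting.
Context {R : realType} {nJ nI : nat}.
Local Open Scope classical_set_scope.
Local Open Scope ring_scope.
Context (A : 'M[R]_(nJ, nI)) (nu mu kappa : 'cV[R]_nI) (alpha : R).
Context (A01 : forall j i, A j i = 0 \/ A j i = 1).
Context (Arow : forall j, exists i, A j i = 1).
Context (nu_gt0 : forall i, 0 < nu i 0) (mu_gt0 : forall i, 0 < mu i 0).
Context (kappa_gt0 : forall i, 0 < kappa i 0) (alpha_gt0 : 0 < alpha).

Implicit Types (x y m : 'cV[R]_nI) (w : 'cV[R]_nJ) (c d e eta B K V : R).

Let A_ge0 j i : 0 <= A j i. Proof. by case: (A01 j i) => ->. Qed.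

(** The marginal utility of bandwidth on route [i] at the balanced rates [nu / mu].
    It is also [mu i 0] times the partial derivative of the lifting cost: this
    coincidence is what makes the lifting cost a Lyapunov function. *)
Definition price (x : 'cV[R]_nI) i :=
  kappa i 0 * (nu i 0 / mu i 0) `^ (- alpha) * x i 0 `^ alpha.

Let k i := kappa i 0 * (nu i 0 / mu i 0) `^ (- alpha) / (mu i 0 * (alpha + 1)).

Let F := lifting_cost nu mu kappa alpha.

Let a1_gt0 : 0 < alpha + 1. Proof. by rewrite addr_gt0. Qed.

Let k_gt0 i : 0 < k i.
Proof.
by rewrite /k divr_gt0 ?mulr_gt0 ?powR_gt0 ?divr_gt0.
Qed.

Let k_ge0 i : 0 <= k i. Proof. exact: ltW. Qed.

Let FE x : (forall i, 0 <= x i 0) -> F x = \sum_i k i * x i 0 `^ (alpha + 1).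
Proof.
move=> x0; rewrite /F /lifting_cost mulr_sumr; apply: eq_bigr => i _.
have [nui mui] := (nu_gt0 i, mu_gt0 i).
have [nu0 mu0] := (ltW nui, ltW mui).
rewrite /k !powRM ?invr_ge0// !powR_inv// !powRN.
rewrite (powRD (x := nu i 0)) ?(gt_eqF nui) ?implybT// powRr1//.
rewrite (powRD (x := x i 0) (r := alpha)); last by rewrite (gt_eqF a1_gt0).
rewrite powRB ?(gt_eqF mui) ?implybT// !powRr1//.
have : nu i 0 `^ alpha != 0 by rewrite gt_eqF// powR_gt0.
have : mu i 0 `^ alpha != 0 by rewrite gt_eqF// powR_gt0.
set a := nu i 0 `^ alpha; set b := mu i 0 `^ alpha => b0 a0.
by field; rewrite a0 b0 !gt_eqF.
Qed.

Let kprice x i : (alpha + 1) * k i * x i 0 `^ alpha = price x i / mu i 0.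
Proof.
have mui := mu_gt0 i.
by rewrite /k /price; field; rewrite !gt_eqF.
Qed.

Lemma lifting_cost_tangent x y : (forall i, 0 <= x i 0) -> (forall i, 0 <= y i 0) ->
  F y - F x <= \sum_i price y i / mu i 0 * (y i 0 - x i 0).
Proof.
move=> x0 y0; rewrite !FE// -sumrB; apply: ler_sum => i _.
rewrite -kprice -mulrBr.
have -> : (alpha + 1) * k i * y i 0 `^ alpha * (y i 0 - x i 0) =
  k i * ((alpha + 1) * y i 0 `^ alpha * (y i 0 - x i 0)) by ring.
by rewrite ler_pM2l// powR_tangent.
Qed.

Let F_le x y : (forall i, 0 <= x i 0) -> (forall i, x i 0 <= y i 0) -> F x <= F y.
Proof.
move=> x0 xy; have y0 i : 0 <= y i 0 by rewrite (le_trans (x0 i)).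
rewrite !FE//; apply: ler_sum => i _; rewrite ler_wpM2l ?(ltW (k_gt0 i))//.
by apply: ge0_ler_powR; rewrite ?nnegrE//; have := alpha_gt0; lra.
Qed.

Let F_lip B : 0 <= B -> exists2 K, 0 <= K & forall e (x y : 'cV[R]_nI),
  (forall i, 0 <= x i 0 <= B) -> (forall i, 0 <= y i 0 <= B) ->
  (forall i, `|x i 0 - y i 0| <= e) -> F x <= F y + K * e.
Proof.
move=> B0; have a1 := ltW a1_gt0.
exists (\sum_i k i * ((alpha + 1) * B `^ alpha)) => [|e x y xB yB xy].
  by apply: sumr_ge0 => i _; rewrite (mulr_ge0 (k_ge0 i))// mulr_ge0// powR_ge0.
rewrite !FE; [|by move=> i; have /andP[] := yB i|by move=> i; have /andP[] := xB i].
rewrite -lerBlDl -sumrB mulr_suml; apply: ler_sum => i _.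
rewrite -mulrBr -[leRHS]mulrA ler_pM2l//.
have /andP[x0 xi] := xB i; have /andP[y0 yi] := yB i.
apply: le_trans (powR_lipschitz alpha_gt0 x0 xi y0 yi) _.
by rewrite ler_wpM2l// mulr_ge0 ?powR_ge0.
Qed.

Let F_bounded V : exists2 B, 1 <= B & forall x : 'cV[R]_nI,
  (forall i, 0 <= x i 0) -> F x <= V -> forall i, x i 0 <= B.
Proof.
exists (1 + \sum_i `|V| / k i) => [|x x0 xV i].
  by rewrite lerDl sumr_ge0// => i _; rewrite divr_ge0.
have [x1|x1] := leP (x i 0) 1.
  by apply: le_trans x1 _; rewrite lerDl sumr_ge0// => j _; rewrite divr_ge0.
have : x i 0 <= `|V| / k i.
  rewrite ler_pdivlMr// mulrC; apply: le_trans (ler_norm V).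
  apply: le_trans xV; rewrite FE//.
  apply: (@le_trans _ _ (k i * x i 0 `^ (alpha + 1))).
    by rewrite ler_pM2l// le1r_powR ?(ltW x1)//; have := alpha_gt0; lra.
  by apply: (@sum_ge_term _ _ (fun i => k i * x i 0 `^ (alpha + 1))) => j;
    rewrite (mulr_ge0 (k_ge0 j))// powR_ge0.
have : `|V| / k i <= \sum_i `|V| / k i.
  by apply: (@sum_ge_term _ _ (fun i => `|V| / k i)) => j; rewrite divr_ge0.
lra.
Qed.

(** The lifting map chooses a minimizer, and a choice need not commute with
    rescaling; being a minimizer does. *)
Definition is_lifting w m := lifting_feasible A mu w m /\
  forall m', lifting_feasible A mu w m' -> F m <= F m'.

(** Capping a feasible state at [B] keeps it feasible, because a single capped
    coordinate already carries the required workload, and lowers its cost; so it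
    suffices to minimize over a box. *)
Lemma lifting_exists w : exists m, is_lifting w m.
Proof.
pose B := (\sum_i mu i 0) * \sum_j `|w j 0|.
have wB j i : w j 0 <= B / mu i 0.
  have : mu i 0 <= \sum_i mu i 0.
    by apply: (sum_ge_term (f := fun i => mu i 0)) => l; exact: ltW.
  have : `|w j 0| <= \sum_j `|w j 0| by apply: (sum_ge_term (f := fun j => `|w j 0|)).
  have := mu_gt0 i; have := ler_norm (w j 0); have := normr_ge0 (w j 0).
  rewrite /B ler_pdivlMr//; nra.
have B0 : 0 <= B by rewrite mulr_ge0// sumr_ge0// => i _; exact: ltW.
pose a : 'M[R]_(nJ, nI) := \matrix_(j, i) (- (A j i / mu i 0)).
have aE (x : 'cV[R]_nI) j :
    \sum_i a j i * x i 0 = - \sum_i A j i * (x i 0 / mu i 0).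
  by rewrite -sumrN; apply: eq_bigr => i _; rewrite mxE; ring.
pose g i (x : R) := - (k i * Num.max x 0 `^ (alpha + 1)).
have gc i : continuous (g i).
  move=> x; apply: cvgN; apply: cvgM; first exact: cvg_cst.
  by apply: continuous_powR_max0; have := alpha_gt0; lra.
pose D := [set x : 'cV[R]_nI | (forall i, 0 <= x i 0 <= B) /\
   forall j, \sum_i a j i * x i 0 <= (- w) j 0].
have DE (x : 'cV[R]_nI) : (forall i, 0 <= x i 0 <= B) ->
    lifting_feasible A mu w x -> D x.
  by move=> xB [x0 xw]; split=> // j; rewrite aE mxE lerN2.
have feasible_min (x : 'cV[R]_nI) : lifting_feasible A mu w x ->
    D (\col_i Num.min (x i 0) B).
  move=> [x0 xw]; have m0 i : 0 <= Num.min (x i 0) B by rewrite le_min x0 B0.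
  apply: DE => [i|]; first by rewrite mxE m0 ge_min lexx orbT.
  split=> [i|j]; first by rewrite mxE.
  have [/existsP[i /andP[/eqP Aji xB]]|/existsPn noB] :=
    boolP [exists i, (A j i == 1) && (B < x i 0)].
    apply: le_trans (wB j i) _; rewrite (bigD1 i)//= Aji mul1r mxE.
    rewrite (min_idPr (ltW xB)) lerDl sumr_ge0// => l _.
    by rewrite mxE mulr_ge0// divr_ge0 ?(ltW (mu_gt0 _)).
  apply: le_trans (xw j) _; apply: ler_sum => i _; rewrite mxE.
  have := noB i; case: (A01 j i) => ->; first by rewrite !mul0r.
  by rewrite eqxx/= -leNgt => /min_idPl ->.
have D0 : D !=set0.
  exists (\col_i Num.min ((const_mx B : 'cV[R]_nI) i 0) B); apply: feasible_min; split=> [i|j].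
    by rewrite mxE.
  have [i Aji] := Arow j; apply: le_trans (wB j i) _.
  rewrite (bigD1 i)//= Aji mul1r mxE lerDl sumr_ge0// => l _.
  by rewrite mxE mulr_ge0// divr_ge0 ?(ltW (mu_gt0 _)).
have [m [mB mw] mmax] := separable_max gc D0.
have m0 i : 0 <= m i 0 by have /andP[] := mB i.
have gE (x : 'cV[R]_nI) : (forall i, 0 <= x i 0) -> \sum_i g i (x i 0) = - F x.
  move=> x0; rewrite FE// -sumrN; apply: eq_bigr => i _; rewrite /g.
  by rewrite (max_idPl (x0 i)).
exists m; split=> [|x xf].
  by split=> // j; have := mw j; rewrite aE mxE lerN2.
have [x0 _] := xf; have Dx := feasible_min _ xf.
have c0 i : 0 <= (\col_i Num.min (x i 0) B) i 0 by have /andP[] := Dx.1 i.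
apply: (@le_trans _ _ (F (\col_i Num.min (x i 0) B))).
  by have := mmax _ Dx; rewrite !gE// lerN2.
by apply: F_le => // i; rewrite mxE ge_min lexx.
Qed.

Let lift := lifting A nu mu kappa alpha.

Lemma liftingP w : is_lifting w (lift w).
Proof. exact: (xgetPex 0 (lifting_exists w)). Qed.

Lemma is_lifting_scale c w m : 0 < c -> is_lifting w m ->
  is_lifting (c *: w) (c *: m).
Proof.
move=> c0 [[m0 mw] mmin].
have FZ d (x : 'cV[R]_nI) : 0 < d -> (forall i, 0 <= x i 0) ->
    F (d *: x) = d `^ (alpha + 1) * F x.
  move=> d0 x0; rewrite !FE// => [|i]; last by rewrite mxE mulr_ge0// ltW.
  rewrite mulr_sumr; apply: eq_bigr => i _.
  by rewrite mxE powRM ?(ltW d0)// mulrCA.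
have feasZ d w' x : 0 < d -> lifting_feasible A mu w' x ->
    lifting_feasible A mu (d *: w') (d *: x).
  move=> d0 [x0 xw]; split=> [i|j]; first by rewrite mxE mulr_ge0// ltW.
  rewrite mxE; apply: le_trans (ler_wpM2l (ltW d0) (xw j)) _.
  rewrite mulr_sumr; apply: ler_sum => i _.
  by rewrite mxE mulrCA !mulrA.
split=> [|m' m'f]; first exact: feasZ.
have ci : 0 < c^-1 by rewrite invr_gt0.
have := feasZ _ _ _ ci m'f; rewrite scalerA mulVf ?gt_eqF// scale1r.
move=> /mmin; rewrite !FZ//; last by have [] := m'f.
rewrite -ler_pdivrMl ?powR_gt0// => le; apply: le_trans _ le.
by rewrite powR_inv ?(ltW c0)// invrK.
Qed.

Lemma is_lifting_cost w m : is_lifting w m -> F m = F (lift w).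
Proof.
move=> [mf mmin]; have [lf lmin] := liftingP w.
by apply/eqP; rewrite eq_le mmin// lmin.
Qed.

(** Adding [e *: mu] to a state raises every workload by at least [e], because
    every resource is used by some route. *)
Let lift_perturb V : exists2 K, 0 <= K & forall w w' e, 0 <= e -> e <= 1 ->
  F (lift w) <= V -> (forall j, w' j 0 <= w j 0 + e) ->
  F (lift w') <= F (lift w) + K * e.
Proof.
have [B B1 Bb] := F_bounded V.
pose S := \sum_i mu i 0; have muS i : mu i 0 <= S.
  by apply: (sum_ge_term (f := fun i => mu i 0)) => l; exact: ltW.
have S0 : 0 <= S by rewrite sumr_ge0// => i _; exact: ltW.
have BS : 0 <= B + S by lra.
have [K K0 Klip] := F_lip BS.
exists (K * S) => [|w w' e e0 e1 wV w'w]; first exact: mulr_ge0.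
have [lf _] := liftingP w; have [l0 lw] := lf.
have lB := Bb _ l0 wV.
pose y : 'cV[R]_nI := \col_i (lift w i 0 + e * mu i 0).
have emu i : 0 <= e * mu i 0 by rewrite mulr_ge0 ?(ltW (mu_gt0 i)).
have y0 i : 0 <= y i 0 by rewrite mxE addr_ge0.
have yf : lifting_feasible A mu w' y.
  split=> // j; apply: le_trans (w'w j) _.
  under eq_bigr do rewrite mxE mulrDl mulfK ?gt_eqF// mulrDr.
  rewrite big_split/=; apply: lerD (lw j) _.
  have [i Aji] := Arow j; rewrite (bigD1 i)//= Aji mul1r lerDl.
  by rewrite sumr_ge0// => l _; rewrite mulr_ge0.
apply: le_trans ((liftingP w').2 _ yf) _.
rewrite -mulrA; apply: Klip => i; rewrite ?y0 ?l0 ?mxE//=.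
- have := lB i; have : e * mu i 0 <= 1 * S by rewrite ler_pM ?(ltW (mu_gt0 i)).
  by lra.
- by have := lB i; lra.
- rewrite addrAC subrr add0r ger0_norm// mulrC.
  by rewrite ler_wpM2r.
Qed.

Definition limit_workload x : 'cV[R]_nJ := \col_j \sum_i A j i * (x i 0 / mu i 0).

(** The excess cost of a state over the cheapest state with the same workload. It
    is nonnegative and vanishes exactly at the states fixed by the lifting map. *)
Definition gap x := F x - F (lift (limit_workload x)).

Let V0 := F (const_mx 1).

Let cost_box x : (forall i, 0 <= x i 0 <= 1) -> F x <= V0.
Proof. by move=> xB; apply: F_le => i; have /andP[] := xB i; rewrite ?mxE. Qed.

Let feas_self x : (forall i, 0 <= x i 0) ->
  lifting_feasible A mu (limit_workload x) x.
Proof. by move=> x0; split=> // j; rewrite mxE. Qed.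

Let lift_box x : (forall i, 0 <= x i 0 <= 1) -> F (lift (limit_workload x)) <= V0.
Proof.
move=> xB; apply: le_trans (cost_box xB); apply: (liftingP _).2.
by apply: feas_self => i; have /andP[] := xB i.
Qed.

Lemma lift_cost_lipschitz : exists2 K, 0 <= K & forall x w e,
  (forall i, 0 <= x i 0 <= 1) -> 0 <= e -> e <= 1 ->
  (forall j, w j 0 <= limit_workload x j 0 + e) ->
  F (lift w) <= F (lift (limit_workload x)) + K * e.
Proof.
have [K K0 HK] := lift_perturb V0; exists K => // x w e xB e0 e1.
by apply: HK => //; exact: lift_box.
Qed.

(** A state of small gap, pushed up by [e *: mu], is feasible for [w] and almost
    optimal; were it far from the optimum [m], uniform convexity would make the
    midpoint of the two cheaper than [m]. *)
Lemma gap_small d : 0 < d -> exists2 e, 0 < e & forall x w m,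
  (forall i, 0 <= x i 0 <= 1) -> is_lifting w m ->
  (forall j, `|w j 0 - limit_workload x j 0| <= e) -> gap x <= e ->
  forall i, `|x i 0 - m i 0| <= d.
Proof.
move=> d0.
have [K1 K10 H1] := lift_perturb V0; have [K2 K20 H2] := lift_perturb (V0 + K1).
have [B B1 HB] := F_bounded (V0 + K1).
pose S := \sum_i mu i 0; have muS i : mu i 0 <= S.
  by apply: (sum_ge_term (f := fun i => mu i 0)) => l; exact: ltW.
have S0 : 0 <= S by rewrite sumr_ge0// => i _; exact: ltW.
have BS : 0 <= B + S by lra.
have [K3 K30 H3] := F_lip BS.
have d20 : 0 < d / 2 by lra.
have [s s0 Hs] := powR_midpoint alpha_gt0 d20 BS.
have [k0 k00 Hk] := finite_lower_bound k_gt0.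
pose Q := K3 * S + K2 + 1.
have KS0 : 0 <= K3 * S by rewrite mulr_ge0.
have Q0 : 0 < Q by rewrite /Q; lra.
pose e := Num.min 1 (Num.min (k0 * s / Q) (d / (2 * (S + 1)))).
have e0 : 0 < e.
  by rewrite !lt_min ltr01 !divr_gt0 ?mulr_gt0//; lra.
have e1 : e <= 1 by rewrite ge_min lexx.
have eQ : e * Q <= k0 * s by rewrite -ler_pdivlMr// !ge_min lexx !orbT.
have eS : e * S <= d / 2.
  have : e * (2 * (S + 1)) <= d.
    by rewrite -ler_pdivlMr ?mulr_gt0 ?ge_min ?lexx ?orbT//; lra.
  lra.
exists e => // x w m xB wm wx gx i.
have [mf mmin] := wm; have [m0 _] := mf.
have x0 l : 0 <= x l 0 by have /andP[] := xB l.
have Fm : F m <= V0 + K1.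
  rewrite (is_lifting_cost wm).
  apply: le_trans (H1 _ w e (ltW e0) e1 (lift_box xB) _) _ => [j|].
    by have := wx j; rewrite ler_norml => /andP[]; lra.
  have : K1 * e <= K1 * 1 by rewrite ler_wpM2l.
  by have := lift_box xB; lra.
have mB l : m l 0 <= B by apply: HB.
pose y : 'cV[R]_nI := \col_l (x l 0 + e * mu l 0).
have emu l : 0 <= e * mu l 0 by rewrite mulr_ge0 ?(ltW (mu_gt0 l))// ltW.
have emuS l : e * mu l 0 <= e * S by rewrite ler_pM2l.
have y0 l : 0 <= y l 0 by rewrite mxE addr_ge0.
have yB l : y l 0 <= B + S.
  rewrite mxE; have /andP[_ x1] := xB l.
  have : e * S <= 1 * S by rewrite ler_wpM2r.
  by have := emuS l; lra.
have yf : lifting_feasible A mu w y.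
  split=> // j.
  under eq_bigr do rewrite mxE mulrDl mulfK ?gt_eqF// mulrDr.
  rewrite big_split/=; have [l Ajl] := Arow j.
  have -> : w j 0 = limit_workload x j 0 + (w j 0 - limit_workload x j 0) by lra.
  rewrite [X in X + _ <= _]mxE; apply: lerD => //.
  apply: le_trans (ler_norm _) _; apply: le_trans (wx j) _.
  rewrite (bigD1 l)//= Ajl mul1r lerDl.
  by rewrite sumr_ge0// => l' _; rewrite mulr_ge0// ltW.
have Fy : F y <= F m + e * Q.
  have h1 : F y <= F x + K3 * (e * S).
    apply: H3 => l; rewrite ?y0 ?yB ?x0//=; have /andP[_ x1] := xB l; first lra.
    by rewrite mxE addrAC subrr add0r ger0_norm.
  have h2 : F (lift (limit_workload x)) <= F m + K2 * e.
    rewrite (is_lifting_cost wm); apply: H2 => //; first exact: ltW.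
      by rewrite -(is_lifting_cost wm).
    by move=> j; have := wx j; rewrite ler_norml => /andP[]; lra.
  by move: gx; rewrite /gap /Q; lra.
pose z : 'cV[R]_nI := \col_l ((y l 0 + m l 0) / 2).
have zE l : z l 0 = (y l 0 + m l 0) / 2 by rewrite mxE.
have z0 l : 0 <= z l 0 by rewrite zE; have := y0 l; have := m0 l; lra.
have zf : lifting_feasible A mu w z.
  split=> // j; have := yf.2 j; have := mf.2 j => h1 h2.
  have -> : \sum_l A j l * (z l 0 / mu l 0) =
      2^-1 * (\sum_l A j l * (y l 0 / mu l 0) + \sum_l A j l * (m l 0 / mu l 0)).
    by rewrite -big_split/= mulr_sumr; apply: eq_bigr => l _; rewrite zE; ring.
  lra.
rewrite leNgt; apply/negP => xmi.
have ymi : d / 2 <= `|y i 0 - m i 0|.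
  have := ler_normB (y i 0 - m i 0) (e * mu i 0).
  have -> : y i 0 - m i 0 - e * mu i 0 = x i 0 - m i 0 by rewrite mxE; ring.
  by rewrite (ger0_norm (emu i)); have := emuS i; lra.
(* uniform convexity in the coordinate [i], plain convexity in the others *)
have Fz : F z + k i * s <= (F y + F m) / 2.
  rewrite !FE// -big_split/= mulr_suml.
  rewrite (bigD1 i)//= [leRHS](bigD1 i)//= addrAC; apply: lerD.
    rewrite zE -!mulrDr -[leRHS]mulrA ler_pM2l//; apply: Hs => //.
    by have := mB i; lra.
  apply: ler_sum => l _; rewrite zE -mulrDr -[leRHS]mulrA ler_pM2l//.
  exact: powR_midpoint_le.
have : k0 * s <= k i * s by rewrite ler_pM2r.
have := mulr_gt0 k00 s0.
by have := mmin _ zf; lra.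
Qed.

Lemma gap_initial d : 0 < d -> exists2 e, 0 < e & forall x w m,
  (forall i, 0 <= x i 0 <= 1) -> is_lifting w m ->
  (forall j, `|w j 0 - limit_workload x j 0| <= e) ->
  (forall i, `|x i 0 - m i 0| <= e) -> gap x <= d.
Proof.
move=> d0; have [K1 K10 H1] := lift_cost_lipschitz.
have B0 : 0 <= 2 :> R by lra.
have [K3 K30 H3] := F_lip B0.
pose e := Num.min 1 (d / (K1 + K3 + 1)).
have e0 : 0 < e by rewrite lt_min ltr01 divr_gt0//; lra.
have e1 : e <= 1 by rewrite ge_min lexx.
have eQ : e * (K1 + K3 + 1) <= d.
  by rewrite -ler_pdivlMr ?ge_min ?lexx ?orbT//; lra.
exists e => // x w m xB wm wx xm; rewrite /gap.
have x0 l : 0 <= x l 0 by have /andP[] := xB l.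
have h1 : F x <= F m + K3 * e.
  apply: H3 => // l; have /andP[_ x1] := xB l; first by rewrite x0; lra.
  by have [[-> _] _] := wm; have := xm l; rewrite ler_norml => /andP[]; lra.
have h2 : F m <= F (lift (limit_workload x)) + K1 * e.
  rewrite (is_lifting_cost wm); apply: H1 => //; first exact: ltW.
  by move=> j; have := wx j; rewrite ler_norml => /andP[]; lra.
lra.
Qed.

Lemma price_modulus d : 0 < d -> exists2 e, 0 < e & forall x y,
  (forall i, 0 <= x i 0 <= 1) -> (forall i, 0 <= y i 0 <= 1) ->
  (forall i, `|x i 0 - y i 0| < e) -> forall i, `|price x i - price y i| <= d.
Proof.
move=> d0; pose c i := kappa i 0 * (nu i 0 / mu i 0) `^ (- alpha).
have c0 i : 0 < c i by rewrite mulr_gt0 ?powR_gt0 ?divr_gt0.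
have h i : exists e, 0 < e /\ forall x y : R, 0 <= x -> x <= 1 -> 0 <= y ->
    y <= 1 -> `|x - y| < e -> `|x `^ alpha - y `^ alpha| <= d / c i.
  have [e e0 He] := powR_modulus alpha_gt0 (divr_gt0 d0 (c0 i)) ler01.
  by exists e.
have [f fP] := choice h.
have [e e0 ef] := finite_lower_bound (fun i => (fP i).1).
exists e => // x y xB yB xy i.
have /andP[x0 x1] := xB i; have /andP[y0 y1] := yB i.
rewrite /price -mulrBr normrM (gtr0_norm (c0 i)) mulrC -ler_pdivlMr//.
by apply: (fP i).2 => //; exact: lt_le_trans (ef i).
Qed.

Lemma price_bounded : exists2 K, 0 <= K & forall x,
  (forall i, 0 <= x i 0 <= 1) -> forall i, 0 <= price x i <= K.
Proof.
pose c i := kappa i 0 * (nu i 0 / mu i 0) `^ (- alpha).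
have c0 i : 0 <= c i by rewrite mulr_ge0 ?powR_ge0// ltW.
exists (\sum_i c i) => [|x xB i]; first exact: sumr_ge0.
have /andP[x0 x1] := xB i; rewrite /price -/(c i) mulr_ge0 ?powR_ge0//=.
apply: le_trans (sum_ge_term i c0); rewrite -[leRHS]mulr1 ler_wpM2l//.
exact: powR_le1.
Qed.

Section Drift.
Context (C : 'cV[R]_nJ) (Acol : forall i, exists j, A j i = 1).
Context (heavy : forall j, \sum_i A j i * (nu i 0 / mu i 0) = C j 0).

Let rho : 'cV[R]_nI := \col_i (nu i 0 / mu i 0).
Let rho_gt0 i : 0 < rho i 0. Proof. by rewrite mxE divr_gt0. Qed.
Let Arho j : \sum_i A j i * rho i 0 = C j 0.
Proof. by rewrite -heavy; apply: eq_bigr => i _; rewrite mxE. Qed.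

Lemma capacity_sum_ge0 : 0 <= \sum_j C j 0.
Proof. by apply: sumr_ge0 => j _; exact: capacity_ge0 A01 rho_gt0 Arho j. Qed.

Lemma allocation_bounds x : (forall i, 0 <= x i 0) ->
  forall i, 0 <= bandwidth A C kappa alpha x i 0 <= \sum_j C j 0.
Proof.
move=> x0 i.
by rewrite (bandwidth_ge0 A01 Acol rho_gt0 Arho kappa_gt0 alpha_gt0 x0)
  (bandwidth_le A01 Acol rho_gt0 Arho kappa_gt0 alpha_gt0 x0).
Qed.

Lemma allocation_capacity x : (forall i, 0 <= x i 0) ->
  forall j, \sum_i A j i * bandwidth A C kappa alpha x i 0 <= C j 0.
Proof.
move=> x0 j.
exact: (bandwidth_capacity A01 Acol rho_gt0 Arho kappa_gt0 alpha_gt0 x0).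
Qed.

(** Homogeneity: the weights scale by the power [alpha] of [l]. *)
Let scaled_drift (l : R) x (L : 'cV[R]_nI) : 0 < l -> (forall i, 0 <= x i 0) ->
  (forall i, 0 < L i 0) -> (forall j, \sum_i A j i * L i 0 <= C j 0) ->
  \sum_i kappa i 0 * x i 0 `^ alpha * L i 0 `^ (- alpha) * (L i 0 - rho i 0) <=
  \sum_i price x i * (bandwidth A C kappa alpha (l *: x) i 0 - nu i 0 / mu i 0).
Proof.
move=> l0 x0 L0 LC.
have lx0 i : 0 <= (l *: x) i 0 by rewrite mxE mulr_ge0// ltW.
have h := bandwidth_drift A01 Acol rho_gt0 Arho kappa_gt0 alpha_gt0 lx0 L0 LC.
have la0 : 0 < l `^ alpha by rewrite powR_gt0.
rewrite -(ler_pM2l la0) !mulr_sumr.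
apply: le_trans (le_trans _ h) _; apply: ler_sum => i _;
  rewrite (_ : (l *: x) i 0 = l * x i 0) ?mxE// powRM// ?(ltW l0)//.
  by rewrite le_eqVlt; apply/orP; left; apply/eqP; ring.
by rewrite /price le_eqVlt; apply/orP; left; apply/eqP; ring.
Qed.

Lemma drift_ge0 (l : R) x : 0 < l -> (forall i, 0 <= x i 0) ->
  0 <= \sum_i price x i * (bandwidth A C kappa alpha (l *: x) i 0 - nu i 0 / mu i 0).
Proof.
move=> l0 x0; apply: le_trans (scaled_drift l0 x0 rho_gt0 _); last first.
  by move=> j; rewrite Arho.
by rewrite big1// => i _; rewrite subrr mulr0.
Qed.

(** If [m] is the cheapest state with the workload of [x], then
    [z = (m - x) / mu] satisfies [A z >= 0], so the rates [rho - t * z] are feasible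
    for small [t]. Comparing the allocation with them gives a drift of at least
    [t * \sum_i price x i * (- z i)] up to [o(t)], and by convexity of the cost
    that sum is at least the gap. *)
Lemma drift_ge_gap eta : 0 < eta -> exists2 c, 0 < c & forall (l : R) x,
  0 < l -> (forall i, 0 <= x i 0 <= 1) -> eta <= gap x ->
  c <= \sum_i price x i * (bandwidth A C kappa alpha (l *: x) i 0 - nu i 0 / mu i 0).
Proof.
move=> eta0; have [B B1 HB] := F_bounded V0.
have [m0' m0'0 Hm] := finite_lower_bound mu_gt0.
pose Z := B / m0'; have Z0 : 0 < Z by rewrite divr_gt0//; lra.
pose S := \sum_i kappa i 0.
have S0 : 0 <= S by apply: sumr_ge0 => i _; exact: ltW.
pose e := eta / (2 * (S * Z + 1)).
have SZ0 : 0 <= S * Z by rewrite mulr_ge0// ltW.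
have e0 : 0 < e by rewrite divr_gt0//; lra.
have h i : exists d, 0 < d /\ forall y : R, `|y - rho i 0| < d ->
    `|y `^ (- alpha) - rho i 0 `^ (- alpha)| <= e.
  have /cvgrPdist_le/(_ e e0) := @continuous_powR_pos R (- alpha) _ (rho_gt0 i).
  move=> /nbhs_ballP[d /= d0 Hd]; exists d; split=> // y yd; rewrite distrC.
  by apply: Hd; rewrite /ball/= distrC.
have [f fP] := choice h.
have f0 i : 0 < Num.min (f i) (rho i 0) by rewrite lt_min (fP i).1 rho_gt0.
have [t' t'0 Ht'] := finite_lower_bound f0.
pose t := t' / (2 * Z); have t0 : 0 < t by rewrite divr_gt0//; lra.
have tZ : t * Z = t' / 2 by rewrite /t; field; rewrite gt_eqF.
exists (t * (eta / 2)) => [|l x l0 xB gx]; first by rewrite mulr_gt0//; lra.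
have x0 i : 0 <= x i 0 by have /andP[] := xB i.
set m := lift (limit_workload x).
have [[m0 mw] _] := liftingP (limit_workload x); rewrite -/m in m0 mw.
have mB i : m i 0 <= B by apply: HB => //; exact: lift_box.
pose z i := (m i 0 - x i 0) / mu i 0.
have zZ i : `|z i| <= Z.
  rewrite normrM normfV (gtr0_norm (mu_gt0 i)) /Z; apply: ler_pM => //.
    by rewrite invr_ge0 ltW.
    by have /andP[_ x1] := xB i; rewrite ler_norml; have := m0 i;
      have := x0 i; have := mB i; lra.
  by rewrite lef_pV2 ?posrE.
pose L : 'cV[R]_nI := \col_i (rho i 0 - t * z i).
have Lrho i : `|L i 0 - rho i 0| < Num.min (f i) (rho i 0).
  rewrite mxE addrAC subrr add0r normrN normrM (gtr0_norm t0).
  apply: lt_le_trans (Ht' i); apply: le_lt_trans (ler_wpM2l (ltW t0) (zZ i)) _.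
  by rewrite tZ; lra.
have L0 i : 0 < L i 0.
  by have := Lrho i; rewrite lt_min => /andP[_]; rewrite ltr_norml => /andP[]; lra.
have LC j : \sum_i A j i * L i 0 <= C j 0.
  rewrite -Arho; have := mw j; rewrite mxE => h1.
  have -> : \sum_i A j i * L i 0 = \sum_i A j i * rho i 0 -
      t * (\sum_i A j i * (m i 0 / mu i 0) - \sum_i A j i * (x i 0 / mu i 0)).
    rewrite -sumrB mulr_sumr -sumrB; apply: eq_bigr => i _; rewrite mxE /z; ring.
  by rewrite gerBl mulr_ge0 ?(ltW t0)// subr_ge0.
apply: le_trans (scaled_drift l0 x0 L0 LC).
(* convexity of the cost in the direction [m - x] *)
have conv : eta <= \sum_i price x i * - z i.
  apply: le_trans gx _; rewrite /gap -/m.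
  apply: le_trans (lifting_cost_tangent m0 x0) _; apply: ler_sum => i _.
  by rewrite le_eqVlt; apply/orP; left; apply/eqP; rewrite /z; ring.
(* the slopes of the utility at [L] are close to those at [rho] *)
have err : \sum_i price x i * - z i - eta / 2 <=
    \sum_i kappa i 0 * x i 0 `^ alpha * L i 0 `^ (- alpha) * - z i.
  have : \sum_i kappa i 0 * (e * Z) <= eta / 2.
    rewrite -mulr_suml -/S /e.
    have -> : S * (eta / (2 * (S * Z + 1)) * Z) = (eta / 2) * ((S * Z) / (S * Z + 1)).
      by field; lra.
    rewrite -[leRHS]mulr1 ler_pM2l; last lra.
    by rewrite ler_pdivrMr; lra.
  move=> /(fun h => lerB (lexx (\sum_i price x i * - z i)) h) le1; apply: (le_trans le1).
  rewrite -sumrB; apply: ler_sum => i _.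
  have -> : price x i = kappa i 0 * x i 0 `^ alpha * rho i 0 `^ (- alpha).
    by rewrite /price [rho i 0]mxE; ring.
  have /andP[_ x1] := xB i.
  have xa1 : x i 0 `^ alpha <= 1 by exact: powR_le1.
  have Le : `|L i 0 `^ (- alpha) - rho i 0 `^ (- alpha)| <= e.
    by apply: (fP i).2; apply: lt_le_trans (Lrho i) _; rewrite ge_min lexx.
  move: (z i) (zZ i) => zi zZi.
  have key : kappa i 0 * (x i 0 `^ alpha * (L i 0 `^ (- alpha) -
      rho i 0 `^ (- alpha)) * zi) <= kappa i 0 * (e * Z).
    rewrite ler_pM2l//; apply: le_trans (ler_norm _) _; rewrite !normrM.
    rewrite (ger0_norm (powR_ge0 _ _)).
    apply: ler_pM; rewrite ?powR_ge0 ?mulr_ge0 ?powR_ge0//.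
    by rewrite -[leRHS]mul1r; apply: ler_pM; rewrite ?powR_ge0.
  lra.
rewrite (_ : \sum_i _ = t * \sum_i kappa i 0 * x i 0 `^ alpha * L i 0 `^ (- alpha) * - z i).
  by rewrite ler_pM2l//; lra.
by rewrite mulr_sumr; apply: eq_bigr => i _; rewrite [X in _ * (X - _)]mxE; ring.
Qed.

End Drift.

End Lifting.

(** * Stability of near-fluid paths *)

Section Descent.
Local Open Scope classical_set_scope.
Local Open Scope ring_scope.

(** Lyapunov argument with windows: along the multiples of [b] the function
    stays below [eta / 2], because a window either contains a time at which it
    is below [eta / 4], after which it can only rise by [eta / 4], or is one
    over which it does not rise. *)
Lemma window_descent {R : realType} (g : R -> R) (b U eta : R) : 0 < b ->
  (forall s t, 0 <= s -> s <= t -> t <= U -> t - s <= b ->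
    g t <= g s + eta / 4) ->
  (forall s, 0 <= s -> s + b <= U ->
    (forall u, s <= u -> u <= s + b -> eta / 4 <= g u) -> g (s + b) <= g s) ->
  0 < eta -> g 0 <= eta / 2 -> forall t, 0 <= t -> t <= U -> g t <= eta.
Proof.
move=> b0 short long eta0 g0.
have grid n : n%:R * b <= U -> g (n%:R * b) <= eta / 2.
  elim: n => [|n ih]; first by rewrite mul0r.
  rewrite -natr1 mulrDl mul1r; move: ih; set s := n%:R * b => ih sU.
  have s0 : 0 <= s by rewrite mulr_ge0// ltW.
  have gs : g s <= eta / 2 by apply: ih; lra.
  have [[u [su ut gu]]|nou] := pselect (exists u, [/\ s <= u, u <= s + b &
      g u < eta / 4]).
    have ub : s + b - u <= b by lra.
    by have := short u (s + b) (le_trans s0 su) ut sU ub; lra.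
  apply: le_trans gs; apply: long => // u su ut.
  by rewrite leNgt; apply/negP => gu; apply: nou; exists u.
move=> t t0 tU.
have /andP[] := truncn_itv (divr_ge0 t0 (ltW b0)).
set n := Num.truncn _; rewrite ler_pdivlMr// ltr_pdivrMr// -natr1 mulrDl mul1r.
have := grid n; set s := n%:R * b => gn nt tn.
have s0 : 0 <= s by rewrite mulr_ge0// ltW.
have tb : t - s <= b by lra.
have sU : s <= U by lra.
have := gn sU; have := short s t s0 nt tU tb; lra.
Qed.

(** [T] collects the integrals of the rates [f]. This linear form of the
    monotonicity of the integral is all that the estimates on paths use, so
    they can be proved without mentioning integrals. *)
Definition integrates {R : realType} {nI : nat} (U : R) (f T : 'I_nI -> R -> R) :=
  forall (b : 'I_nI -> R) K s t, 0 <= s -> s <= t -> t <= U ->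
    (forall u, s <= u -> u <= t -> \sum_i b i * f i u <= K) ->
    \sum_i b i * (T i t - T i s) <= K * (t - s).

Lemma integrates_coord {R : realType} {nI : nat} (U M : R) (f T : 'I_nI -> R -> R)
    (i : 'I_nI) (s t : R) :
  integrates U f T -> 0 <= s -> s <= t -> t <= U ->
  (forall u, s <= u -> u <= t -> 0 <= f i u <= M) ->
  0 <= T i t - T i s <= M * (t - s).
Proof.
move=> HT s0 st tU fM.
have pick (a : R) (g : 'I_nI -> R) :
    \sum_k (if k == i then a else 0) * g k = a * g i.
  rewrite (bigD1 i)//= eqxx big1 ?addr0// => k /negbTE ->.
  by rewrite mul0r.
have := HT (fun k => if k == i then 1 else 0) M s t s0 st tU.
rewrite pick mul1r => ->; last first.
  by move=> u su ut; rewrite pick mul1r; have /andP[] := fM u su ut.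
have := HT (fun k => if k == i then -1 else 0) 0 s t s0 st tU.
rewrite pick mul0r mulN1r oppr_le0 => ->//.
by move=> u su ut; rewrite pick mulN1r oppr_le0; have /andP[] := fM u su ut.
Qed.

End Descent.

Section Stability.
Context {R : realType} {nJ nI : nat}.
Local Open Scope classical_set_scope.
Local Open Scope ring_scope.
Context (A : 'M[R]_(nJ, nI)) (nu mu kappa : 'cV[R]_nI) (alpha : R).
Context (A01 : forall j i, A j i = 0 \/ A j i = 1).
Context (Arow : forall j, exists i, A j i = 1).
Context (nu_gt0 : forall i, 0 < nu i 0) (mu_gt0 : forall i, 0 < mu i 0).
Context (kappa_gt0 : forall i, 0 < kappa i 0) (alpha_gt0 : 0 < alpha).
Context (C : 'cV[R]_nJ) (Acol : forall i, exists j, A j i = 1).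
Context (heavy : forall j, \sum_i A j i * (nu i 0 / mu i 0) = C j 0).

Implicit Types x : 'cV[R]_nI.

Local Notation Gap := (gap A nu mu kappa alpha).
Local Notation Price := (price nu mu kappa alpha).
Let Lam := bandwidth A C kappa alpha.

Let cap := \sum_j C j 0.

Let Lam_bounds x : (forall i, 0 <= x i 0) -> forall i, 0 <= Lam x i 0 <= cap.
Proof.
exact: (allocation_bounds A01 nu_gt0 mu_gt0 kappa_gt0 alpha_gt0 Acol heavy).
Qed.

Let Lam_capacity x : (forall i, 0 <= x i 0) ->
  forall j, \sum_i A j i * Lam x i 0 <= C j 0.
Proof.
exact: (allocation_capacity A01 nu_gt0 mu_gt0 kappa_gt0 alpha_gt0 Acol heavy).
Qed.

(** A path that is close to a fluid path on every window. Time is not rescaled: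
    states are divided by [l], and a window has length [h * l], which is the
    hydrodynamic scaling. *)
Record near_fluid (h e l U : R) (X : R -> 'cV[R]_nI) (T : 'I_nI -> R -> R) :
    Prop := {
  near_fluid_box : forall u, 0 <= u -> u <= U -> forall i, 0 <= X u i 0 <= 1 ;
  near_fluid_allocation : integrates U (fun i u => Lam (l *: X u) i 0) T ;
  near_fluid_dynamics : forall s t i, 0 <= s -> s <= t -> t <= U ->
    t - s <= h * l ->
    `|X t i 0 - X s i 0 - (nu i 0 * (t - s) - mu i 0 * (T i t - T i s)) / l|
      <= e }.

(** On a window the cost changes by at most its gradient at the end point times
    the displacement, by convexity, so the prices at that point weigh the
    allocations received; prices oscillate by at most [om] on the window, so the
    drift [D] at each time is integrated. The capacity constraints prevent the
    workload, hence the optimal cost, from decreasing by more than the error. *)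
Lemma gap_step : exists S K : R, [/\ 0 <= S, 0 <= K & forall om : R, 0 < om ->
  exists2 e1 : R, 0 < e1 & forall h e l U X T, 0 < l -> 0 <= h -> 0 <= e ->
  h * S + e < e1 -> K * e <= 1 -> near_fluid h e l U X T ->
  forall D s t, 0 <= s -> s <= t -> t <= U -> t - s <= h * l ->
    (forall u, s <= u -> u <= t -> D <= \sum_i Price (X u) i *
       (Lam (l *: X u) i 0 - nu i 0 / mu i 0)) ->
    Gap (X t) <= Gap (X s) + (om * S - D) * ((t - s) / l) + K * e].
Proof.
have [P P0 HP] := price_bounded nu mu kappa_gt0 alpha_gt0.
have [Kw Kw0 HKw] := lift_cost_lipschitz A01 Arow nu_gt0 mu_gt0 kappa_gt0 alpha_gt0.
have cap0 : 0 <= cap := capacity_sum_ge0 A01 nu_gt0 mu_gt0 heavy.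
pose S1 := \sum_i (nu i 0 + mu i 0 * cap).
pose S2 := \sum_i (cap + nu i 0 / mu i 0).
pose Ka := \sum_i (mu i 0)^-1.
have [nu0 mu0] : (forall i, 0 <= nu i 0) /\ (forall i, 0 <= mu i 0).
  by split=> i; exact: ltW.
have S10 : 0 <= S1 by apply: sumr_ge0 => i _; rewrite addr_ge0 ?mulr_ge0.
have S20 : 0 <= S2 by apply: sumr_ge0 => i _; rewrite addr_ge0 ?divr_ge0.
have Ka0 : 0 <= Ka by apply: sumr_ge0 => i _; rewrite invr_ge0 ltW.
have PKa0 : 0 <= P * Ka by rewrite mulr_ge0.
have KwKa0 : 0 <= Kw * Ka by rewrite mulr_ge0.
exists (S1 + S2), (Ka + P * Ka + Kw * Ka); split; [exact: addr_ge0 |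
  by rewrite !addr_ge0 | move=> om om0].
have [e1 e10 He1] := price_modulus nu_gt0 mu_gt0 kappa_gt0 alpha_gt0 om0.
exists e1 => // h e l U X T l0 h0 e0 he Ke [XB HT Xdyn].
have hS1 : h * S1 + e < e1.
  by apply: le_lt_trans he; rewrite lerD2r ler_wpM2l// lerDl.
have eKa : Ka * e <= 1.
  by apply: le_trans Ke; rewrite ler_wpM2r// -addrA lerDl addr_ge0.
clear he Ke.
have XU u : 0 <= u -> u <= U -> forall i, 0 <= X u i 0.
  by move=> u0 uU i; have /andP[] := XB u u0 uU i.
have LX u i : 0 <= u -> u <= U -> 0 <= Lam (l *: X u) i 0 <= cap.
  move=> u0 uU; apply: Lam_bounds => k.
  by rewrite mxE mulr_ge0 ?(ltW l0)// XU.
have dT s t i : 0 <= s -> s <= t -> t <= U ->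
    0 <= T i t - T i s <= cap * (t - s).
  move=> s0 st tU.
  apply: (integrates_coord HT) => // u su ut.
  exact: LX (le_trans s0 su) (le_trans ut tU).
have close s t i : 0 <= s -> s <= t -> t <= U -> t - s <= h * l ->
    `|X s i 0 - X t i 0| < e1.
  move=> s0 st tU tsh; have := Xdyn s t i s0 st tU tsh.
  have /andP[dT0 dT1] := dT s t i s0 st tU.
  set v := (_ / l) => Hv.
  have vb : `|v| <= h * S1.
    have nui := nu_gt0 i; have mui := mu_gt0 i.
    rewrite normrM normfV (gtr0_norm l0) ler_pdivrMr//.
    apply: (@le_trans _ _ ((nu i 0 + mu i 0 * cap) * (t - s))).
      apply: le_trans (ler_normB _ _) _; rewrite mulrDl !ger0_norm ?mulr_ge0//;
        rewrite ?subr_ge0 ?(ltW nui) ?(ltW mui)//.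
      by rewrite lerD2l -mulrA ler_pM2l.
    apply: (@le_trans _ _ (S1 * (t - s))).
      apply: ler_wpM2r; first by rewrite subr_ge0.
      apply: (sum_ge_term (f := fun i => nu i 0 + mu i 0 * cap)) => k.
      by rewrite addr_ge0 ?mulr_ge0.
    by rewrite mulrAC mulrC; apply: ler_wpM2r.
  rewrite distrC; have -> : X t i 0 - X s i 0 = (X t i 0 - X s i 0 - v) + v by ring.
  apply: le_lt_trans (ler_normD _ _) _; lra.
move=> D s t s0 st tU tsh HD.
  have t0 : 0 <= t by exact: le_trans st.
  have sU : s <= U by exact: le_trans tU.
  have XBt := XB t t0 tU; have XBs := XB s s0 sU.
  (* the drift at each time of the window, at the prices of its end point *)
  have pr : \sum_i Price (X t) i * (nu i 0 / mu i 0 * (t - s) - (T i t - T i s))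
      <= (om * S2 - D) * (t - s).
    have := @HT (fun i => - Price (X t) i)
      (om * S2 - D - \sum_i Price (X t) i * (nu i 0 / mu i 0)) s t s0 st tU.
    move=> HH.
    have -> : \sum_i Price (X t) i * (nu i 0 / mu i 0 * (t - s) - (T i t - T i s))
      = \sum_i - Price (X t) i * (T i t - T i s) +
        (\sum_i Price (X t) i * (nu i 0 / mu i 0)) * (t - s).
      by rewrite mulr_suml -big_split; apply: eq_bigr => i _ /=; ring.
    rewrite -lerBrDr -mulrBl; apply: HH => u su ut.
    have u0 : 0 <= u by exact: le_trans su.
    have uU : u <= U by exact: le_trans tU.
    have e3 : \sum_i (Price (X u) i - Price (X t) i) *
        (Lam (l *: X u) i 0 - nu i 0 / mu i 0) <= om * S2.
      rewrite /S2 mulr_sumr; apply: ler_sum => i _.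
      apply: le_trans (ler_norm _) _; rewrite normrM; apply: ler_pM => //.
        apply: He1 => // [|k]; first exact: XB.
        by apply: close => //; lra.
      have /andP[L0 L1] := LX u i u0 uU.
      apply: le_trans (ler_normB _ _) _.
      by rewrite !ger0_norm ?divr_ge0// lerD2r.
    have := HD u su ut.
    have E : \sum_i (Price (X u) i - Price (X t) i) *
        (Lam (l *: X u) i 0 - nu i 0 / mu i 0) =
      \sum_i Price (X u) i * (Lam (l *: X u) i 0 - nu i 0 / mu i 0) +
      \sum_i Price (X t) i * (nu i 0 / mu i 0) +
      \sum_i - Price (X t) i * Lam (l *: X u) i 0.
      by rewrite -!big_split; apply: eq_bigr => i _ /=; ring.
    rewrite E in e3; lra.
  have cost : lifting_cost nu mu kappa alpha (X t) - lifting_cost nu mu kappa alpha (X s)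
      <= (om * S2 - D) * ((t - s) / l) + e * (P * Ka).
    have tg := lifting_cost_tangent nu_gt0 mu_gt0 kappa_gt0 alpha_gt0
      (XU s s0 sU) (XU t t0 tU).
    apply: (le_trans tg).
    apply: (@le_trans _ _ ((\sum_i Price (X t) i *
        (nu i 0 / mu i 0 * (t - s) - (T i t - T i s))) / l + e * (P * Ka))); last first.
      by rewrite lerD2r [leRHS]mulrA ler_pM2r ?invr_gt0.
    rewrite mulr_suml /Ka !mulr_sumr -big_split; apply: ler_sum => i _ /=.
    have /andP[p0 pP] := HP _ XBt i.
    have mui := mu_gt0 i.
    have := Xdyn s t i s0 st tU tsh; rewrite ler_norml => /andP[_].
    rewrite lerBlDl => /(ler_wpM2l (divr_ge0 p0 (ltW mui))) /le_trans; apply.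
    rewrite mulrDr; apply: lerD.
      by rewrite le_eqVlt; apply/orP; left; apply/eqP; rewrite /price; field; lra.
    by rewrite mulrC ler_wpM2l// ler_wpM2r ?invr_ge0// ltW.
  have load : lifting_cost nu mu kappa alpha (lifting A nu mu kappa alpha
        (limit_workload A mu (X s))) <=
      lifting_cost nu mu kappa alpha (lifting A nu mu kappa alpha
        (limit_workload A mu (X t))) + Kw * (Ka * e).
    apply: HKw => //; first by rewrite mulr_ge0 ?(ltW e0).
    move=> j; rewrite !mxE -lerBlDl -sumrB.
    have capT : \sum_i A j i * (T i t - T i s) <= C j 0 * (t - s).
      apply: HT => // u su ut; apply: Lam_capacity => i.
      by rewrite mxE mulr_ge0 ?(ltW l0)// XU//; lra.
    have cap1 : 0 <= \sum_i A j i * ((nu i 0 / mu i 0 * (t - s) - (T i t - T i s)) / l).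
      have -> : \sum_i A j i * ((nu i 0 / mu i 0 * (t - s) - (T i t - T i s)) / l) =
        (C j 0 * (t - s) - \sum_i A j i * (T i t - T i s)) / l.
        by rewrite -heavy [(\sum_i _) * (t - s)]mulr_suml -sumrB mulr_suml;
          apply: eq_bigr => i _; ring.
      by rewrite divr_ge0 ?(ltW l0)// subr_ge0.
    apply: (@le_trans _ _ (Ka * e -
      \sum_i A j i * ((nu i 0 / mu i 0 * (t - s) - (T i t - T i s)) / l))).
      rewrite /Ka mulr_suml -sumrB; apply: ler_sum => i _.
      have mui := mu_gt0 i; have imu : 0 <= (mu i 0)^-1 by rewrite invr_ge0 ltW.
      case: (A01 j i) => ->.
        by rewrite !mul0r !subr0 mulr_ge0 ?(ltW e0).
      rewrite !mul1r; have := Xdyn s t i s0 st tU tsh.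
      rewrite ler_norml => /andP[/(ler_wpM2l imu) + _].
      have -> : (mu i 0)^-1 * (X t i 0 - X s i 0 -
          (nu i 0 * (t - s) - mu i 0 * (T i t - T i s)) / l) =
        X t i 0 / mu i 0 - X s i 0 / mu i 0 -
          (nu i 0 / mu i 0 * (t - s) - (T i t - T i s)) / l.
        by field; lra.
      lra.
    by rewrite gerBl.
  have Kae0 : 0 <= Ka * e by rewrite mulr_ge0.
  have oms0 : 0 <= om * S1 * ((t - s) / l).
    by rewrite !mulr_ge0 ?invr_ge0 ?subr_ge0 ?(ltW om0) ?(ltW l0).
  rewrite /gap; move: cost load Kae0 oms0; move: ((t - s) / l) => tau.
  move: (lifting_cost _ _ _ _ (X t)) (lifting_cost _ _ _ _ (X s)) => ft fs.
  by move: (lifting_cost _ _ _ _ _) (lifting_cost _ _ _ _ _) => gt gs; clear; lra.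
Qed.

(** The window length and the error depend only on the level [eta], not on the
    length [U] of the path nor on the scale [l]: the horizon contains a number of
    windows that grows with the scaling parameter. *)
Lemma gap_stays_small (eta : R) : 0 < eta -> exists e h : R, [/\ 0 < e, 0 < h &
  forall l U X T, 0 < l -> near_fluid h e l U X T -> Gap (X 0) <= eta / 2 ->
  forall t, 0 <= t -> t <= U -> Gap (X t) <= eta].
Proof.
move=> eta0; have eta40 : 0 < eta / 4 by lra.
have [c c0 Hc] := drift_ge_gap A01 Arow nu_gt0 mu_gt0 kappa_gt0 alpha_gt0
  Acol heavy eta40.
have [S [K [S0 K0 HS]]] := gap_step.
(* the oscillation of the prices over a window is kept below half of the
   drift, then the accumulated error below half of the decrease of the gap *)
have [om [om0 omc ome]] : exists om, [/\ 0 < om, om * S <= c / 2 & om * S <= eta / 8].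
  have min0 : 0 < Num.min (c / 2) (eta / 8) by rewrite lt_min; apply/andP; split; lra.
  exists (Num.min (c / 2) (eta / 8) / (S + 1)).
  have omS : Num.min (c / 2) (eta / 8) / (S + 1) * S <= Num.min (c / 2) (eta / 8).
    by rewrite mulrAC ler_pdivrMr ?ler_pM2l//; lra.
  split; first by rewrite divr_gt0//; lra.
    by apply: le_trans omS _; rewrite ge_min lexx.
  by apply: le_trans omS _; rewrite ge_min lexx orbT.
have [e1 e10 He1] := HS om om0.
have [h [h0 h1 hS]] : exists h, [/\ 0 < h, h <= 1 & h * S < e1 / 2].
  exists (Num.min 1 (e1 / (2 * (S + 1)))); set h := Num.min _ _.
  have : h * (2 * (S + 1)) <= e1.
    by rewrite -ler_pdivlMr ?ge_min ?lexx ?orbT//; lra.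
  have h0 : 0 < h by rewrite lt_min ltr01 divr_gt0//; lra.
  by split=> //; [rewrite ge_min lexx|lra].
have [e [e0 ee1 eK1 eKe eKc]] : exists e, [/\ 0 < e, e <= e1 / 2, K * e <= 1,
    K * e <= eta / 8 & K * e <= c * h / 2].
  have ch0 : 0 < c * h by rewrite mulr_gt0.
  pose q := Num.min 1 (Num.min (eta / 8) (c * h / 2)).
  have q0 : 0 < q by rewrite !lt_min; apply/andP; split; [lra|apply/andP; split; lra].
  pose e := Num.min (e1 / 2) (q / (K + 1)).
  have eK : K * e <= q.
    apply: (@le_trans _ _ (e * (K + 1))); first by rewrite mulrC ler_wpM2l ?lerDl//
      le_min ?divr_ge0 ?(ltW q0) ?(ltW e10)//; lra.
    by rewrite -ler_pdivlMr ?ge_min ?lexx ?orbT//; lra.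
  exists e; split; [by rewrite !lt_min !divr_gt0//; lra | by rewrite ge_min lexx | | |];
    apply: le_trans eK _; by rewrite !ge_min lexx ?orbT.
have he : h * S + e < e1 by lra.
have omc' : om * S - c <= - (c / 2) by lra.
exists e, h; split=> // l U X T l0 nf X0.
have step := He1 _ _ _ _ _ _ l0 (ltW h0) (ltW e0) he eK1 nf.
have [XB HT Xdyn] := nf.
clear Xdyn He1 HS he ee1 eK1 nf.
have XU u : 0 <= u -> u <= U -> forall i, 0 <= X u i 0.
  by move=> u0 uU i; have /andP[] := XB u u0 uU i.
have drift0 u : 0 <= u -> u <= U ->
    0 <= \sum_i Price (X u) i * (Lam (l *: X u) i 0 - nu i 0 / mu i 0).
  move=> u0 uU.
  exact: (drift_ge0 A01 nu_gt0 mu_gt0 kappa_gt0 alpha_gt0 Acol heavy l0 (XU u u0 uU)).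
have hl0 : 0 < h * l by rewrite mulr_gt0.
apply: (window_descent hl0 _ _ eta0 X0) => [s t s0 st tU tsh|s s0 sU gs].
  have b : (om * S - 0) * ((t - s) / l) <= eta / 8 * 1.
    rewrite subr0; apply: ler_pM => //; first by rewrite mulr_ge0// ltW.
      by rewrite divr_ge0 ?(ltW l0)// subr_ge0.
    rewrite ler_pdivrMr// mul1r; apply: le_trans tsh _.
    by rewrite -[leRHS]mul1r ler_pM2r.
  have d0 u : s <= u -> u <= t -> 0 <= \sum_i Price (X u) i *
      (Lam (l *: X u) i 0 - nu i 0 / mu i 0).
    by move=> su ut; apply: drift0; [exact: le_trans su | exact: le_trans tU].
  apply: le_trans (step 0 s t s0 st tU tsh d0) _; rewrite -addrA lerD2l.
  by have -> : eta / 4 = eta / 8 * 1 + eta / 8 by [field]; exact: lerD.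
have := step c s (s + h * l) s0; rewrite lerDl (ltW hl0) => /(_ isT sU).
have -> : s + h * l - s = h * l by ring.
rewrite lexx => /(_ isT) HH; apply: le_trans (HH _) _ => [u su ut|].
  apply: Hc => //; last exact: gs.
  by apply: XB; [exact: le_trans su | exact: le_trans sU].
rewrite (_ : h * l / l = h); last by rewrite mulfK// gt_eqF.
rewrite -addrA gerDl; apply: (@le_trans _ _ (- (c / 2) * h + c * h / 2)).
  by apply: lerD eKc; rewrite ler_wpM2r ?(ltW h0).
by rewrite le_eqVlt; apply/orP; left; apply/eqP; field.
Qed.

End Stability.

(** * Concentration of Poisson processes *)

Section PoissonTail.
Context {R : realType}.
Local Open Scope classical_set_scope.
Local Open Scope ring_scope.
Implicit Types q e x : R.

Lemma exp_partial_sum_le x n : 0 < x ->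
  \sum_(0 <= m < n) x ^+ m / m`!%:R <= expR x.
Proof.
move=> x0; rewrite /expR.
apply: (@nondecreasing_cvgn_le _ (series (exp_coeff x))).
  apply/nondecreasing_seqP => k; rewrite /series/= big_nat_recr//= lerDl.
  by apply: exp_coeff_ge0; exact: ltW.
exact: is_cvg_series_exp_coeff_pos.
Qed.

Lemma poisson_mgf_partial q e n : 0 < q ->
  \sum_(0 <= m < n) poisson_pmf q m * expR (e * m%:R) <=
  expR (q * (expR e - 1)).
Proof.
move=> q0; have qe0 : 0 < q * expR e by rewrite mulr_gt0 ?expR_gt0.
rewrite mulrBr mulr1 expRD -ler_pdivrMr ?expR_gt0//.
apply: le_trans (exp_partial_sum_le n qe0); rewrite mulr_suml; apply: ler_sum => m _.
rewrite /poisson_pmf q0 exprMn mulrC expRM_natr expRN.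
by rewrite le_eqVlt; apply/orP; left; apply/eqP; field; rewrite expR_eq0 pnatr_eq0 -lt0n fact_gt0.
Qed.

Lemma expR_le_quadratic e : 0 <= e -> e <= 2^-1 -> expR e <= 1 + e + 2 * e ^+ 2.
Proof.
move=> e0 e1; have := expR_ge1Dx (- e); rewrite expRN => h.
have p : 0 < 1 - e by lra.
have : expR e <= (1 - e)^-1 by rewrite -[leLHS]invrK lef_pV2 ?posrE// invr_gt0 expR_gt0.
move=> /le_trans; apply; rewrite -[leLHS]mul1r ler_pdivrMr//; nra.
Qed.

Lemma expRN_le_quadratic e : 0 <= e -> expR (- e) <= 1 - e + e ^+ 2.
Proof.
move=> e0; have h := expR_ge1Dx e; rewrite expRN.
have p : 0 < 1 + e by lra.
have : (expR e)^-1 <= (1 + e)^-1 by rewrite lef_pV2 ?posrE// expR_gt0.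
move=> /le_trans; apply; rewrite -[leLHS]mul1r ler_pdivrMr//; nra.
Qed.

Context {d : measure_display} {Omega : measurableType d}.
Context (P : probability Omega R).

Lemma fiber_measurable (T : countType) (f : Omega -> T) :
  (forall x : T, measurable [set w | f w = x]) ->
  forall B : set T, measurable (f @^-1` B).
Proof.
move=> mf B.
have -> : f @^-1` B = \bigcup_n [set w | pickle (f w) = n /\ B (f w)].
  by apply/seteqP; split=> w /=; [exists (pickle (f w)) | case=> n _ []].
apply: bigcup_measurable => n _.
have [[x [xn Bx]]|nox] := pselect (exists x : T, pickle x = n /\ B x).
  suff -> : [set w | pickle (f w) = n /\ B (f w)] = [set w | f w = x] by [].
  apply/seteqP; split=> w /=; last by move=> ->.
  by move=> [fn _]; apply: (pcan_inj pickleK); rewrite fn.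
suff -> : [set w | pickle (f w) = n /\ B (f w)] = set0 by [].
by apply/seteqP; split=> w //= H; apply: nox; exists (f w).
Qed.

(** Chernoff bound with exponents [e / 4] and [- e / 4]. *)
Lemma poisson_tail (X : Omega -> nat) q e : 0 < q -> 0 < e -> e <= 1 ->
  (forall m, measurable [set w | X w = m]) ->
  (forall m, P [set w | X w = m] = (poisson_pmf q m)%:E) ->
  (P [set w | (e * q < `|(X w)%:R - q|)%R] <= (2 * expR (- (q * e ^+ 2 / 8)))%:E)%E.
Proof.
move=> q0 e0 e1 mX pX.
pose tail (m : nat) : bool := e * q < `|m%:R - q|.
pose t := e / 4.
pose g m := poisson_pmf q m * (expR (t * m%:R) * expR (- (t * ((1 + e) * q))) +
  expR (- t * m%:R) * expR (t * ((1 - e) * q))).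
have g_ge m : tail m -> poisson_pmf q m <= g m.
  move=> tm; rewrite -[leLHS]mulr1; apply: ler_wpM2l; first exact: poisson_pmf_ge0.
  rewrite -!expRD; have t0 : 0 < t by rewrite /t; lra.
  have [mq|mq] := leP q m%:R.
    apply: (@le_trans _ _ (expR (t * m%:R - t * ((1 + e) * q)))).
      rewrite -[leLHS]expR0 ler_expR -mulrBr mulr_ge0 ?(ltW t0)//.
      by move: tm; rewrite /tail ger0_norm ?subr_ge0//; lra.
    by rewrite lerDl expR_ge0.
  apply: (@le_trans _ _ (expR (- t * m%:R + t * ((1 - e) * q)))).
    rewrite -[leLHS]expR0 ler_expR mulNr addrC -mulrBr mulr_ge0 ?(ltW t0)//.
    by move: tm; rewrite /tail ltr0_norm ?subr_lt0//; lra.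
  by rewrite lerDr expR_ge0.
pose B m := if tail m then [set w | X w = m] else set0.
have sub : [set w | e * q < `|(X w)%:R - q|] `<=` \bigcup_m B m.
  by move=> w /= tw; exists (X w) => //; rewrite /B /tail tw.
have mtail : measurable [set w | e * q < `|(X w)%:R - q|].
  exact: (fiber_measurable mX [set m | e * q < `|m%:R - q|]).
have mB m : measurable (B m) by rewrite /B; case: ifP.
apply: le_trans (measure_sigma_subadditive P mB mtail sub) _.
apply: lime_le; first exact: is_cvg_nneseries.
apply: nearW => n.
have le1 : (\sum_(0 <= m < n) P (B m) <= (\sum_(0 <= m < n) g m)%:E)%E.
  rewrite -sumEFin; apply: lee_sum => m _; rewrite /B; case: ifP => tm.
    by rewrite pX lee_fin g_ge.
  rewrite measure0 lee_fin mulr_ge0 ?poisson_pmf_ge0// addr_ge0// mulr_ge0 ?expR_ge0//.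
apply: le_trans le1 _; rewrite lee_fin.
have t0 : 0 <= t by rewrite /t; lra.
have t2 : t <= 2^-1 by rewrite /t; lra.
have -> : \sum_(0 <= m < n) g m =
    (\sum_(0 <= m < n) poisson_pmf q m * expR (t * m%:R)) * expR (- (t * ((1 + e) * q))) +
    (\sum_(0 <= m < n) poisson_pmf q m * expR (- t * m%:R)) * expR (t * ((1 - e) * q)).
  by rewrite !mulr_suml -big_split; apply: eq_bigr => m _; rewrite /g/=; ring.
rewrite mulr_natl mulr2n; apply: lerD.
  apply: le_trans (ler_wpM2r (expR_ge0 _) (poisson_mgf_partial t n q0)) _.
  rewrite -expRD ler_expR.
  have : q * (expR t - 1) <= q * (t + 2 * t ^+ 2).
    by rewrite ler_pM2l//; have := expR_le_quadratic t0 t2; lra.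
  have -> : - (q * e ^+ 2 / 8) = q * (t + 2 * t ^+ 2) - t * ((1 + e) * q).
    by rewrite /t; field.
  lra.
apply: le_trans (ler_wpM2r (expR_ge0 _) (poisson_mgf_partial (- t) n q0)) _.
rewrite -expRD ler_expR.
have : q * (expR (- t) - 1) <= q * (- t + 2 * t ^+ 2).
  by rewrite ler_pM2l//; have := expRN_le_quadratic t0; have := sqr_ge0 t; lra.
have -> : - (q * e ^+ 2 / 8) = q * (- t + 2 * t ^+ 2) + t * ((1 - e) * q).
  by rewrite /t; field.
lra.
Qed.

End PoissonTail.

Section Regularity.
Context {R : realType} {d : measure_display} {Omega : measurableType d}.
Local Open Scope classical_set_scope.
Local Open Scope ring_scope.
Context (P : probability Omega R).
Implicit Types (lam a e s t : R) (X : R -> Omega -> nat).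

Definition irregular_step lam a e X (m : nat) : set Omega :=
  [set w | e * (lam * a) <
    `|(X (a * m.+1%:R)%R w - X (a * m%:R)%R w)%N%:R - lam * a|].

Definition irregular lam a e n X : set Omega :=
  \big[setU/set0]_(m < n) irregular_step lam a e X m.

Lemma nat_fiber_measurable lam X t m : poisson_process P lam X -> 0 <= t ->
  measurable [set w | X t w = m].
Proof.
move=> [mX _ _ _ _ _] t0; rewrite (_ : [set _ | _] = setT `&` X t @^-1` [set m]).
  exact: mX.
by rewrite setTI.
Qed.

Lemma increment_measurable lam X s t m : poisson_process P lam X ->
  0 <= s -> 0 <= t -> measurable [set w | (X t w - X s w)%N = m].
Proof.
move=> pX s0 t0; pose f w := (X t w, X s w).
have mf (x : nat * nat) : measurable [set w | f w = x].
  rewrite (_ : [set _ | _] = [set w | X t w = x.1] `&` [set w | X s w = x.2]).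
    by apply: measurableI; exact: nat_fiber_measurable pX _.
  apply/seteqP; split=> w /=; first by rewrite /f => <-.
  by case: x => x1 x2 /= [<- <-].
exact: (fiber_measurable mf [set x | (x.1 - x.2)%N = m]).
Qed.

Lemma irregular_step_measurable lam a e X m : poisson_process P lam X -> 0 <= a ->
  measurable (irregular_step lam a e X m).
Proof.
move=> pX a0.
exact: (fiber_measurable (f := fun w => (X (a * m.+1%:R)%R w - X (a * m%:R)%R w)%N)
  (fun x => increment_measurable x pX (mulr_ge0 a0 (ler0n _ _))
    (mulr_ge0 a0 (ler0n _ _))) [set k | e * (lam * a) < `|k%:R - lam * a|]).
Qed.

Lemma irregular_measurable lam a e n X : poisson_process P lam X -> 0 <= a ->
  measurable (irregular lam a e n X).
Proof.
move=> pX a0; rewrite /irregular -bigcup_mkord; apply: bigcup_measurable => m _.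
exact: irregular_step_measurable.
Qed.

Lemma irregular_le lam a e n X : poisson_process P lam X ->
  0 < lam -> 0 < a -> 0 < e -> e <= 1 ->
  (P (irregular lam a e n X) <=
    (n%:R * (2 * expR (- (lam * a * e ^+ 2 / 8))))%:E)%E.
Proof.
move=> pX lam0 a0 e0 e1; have a0' := ltW a0.
apply: le_trans (content_subadditive P (F := irregular_step lam a e X)
  (fun k _ => irregular_step_measurable e k pX a0')
  (irregular_measurable e n pX a0') _) _; first exact: subset_refl.
have -> : (n%:R * (2 * expR (- (lam * a * e ^+ 2 / 8))))%:E =
    (\sum_(k < n) (2 * expR (- (lam * a * e ^+ 2 / 8)))%:E)%E.
  by rewrite sumEFin sumr_const card_ord mulr_natl.
apply: lee_sum => k _.
have k0 m : 0 <= a * m%:R by rewrite mulr_ge0.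
apply: (poisson_tail (mulr_gt0 lam0 a0) e0 e1) => m.
  exact: increment_measurable pX _ _.
have lt : a * k%:R < a * k.+1%:R by rewrite ltr_pM2l// ltr_nat.
have [_ _ _ _ _ incr] := pX.
by rewrite incr// -mulrBr -natrB// subSnn mulr1.
Qed.

(** Monotonicity transfers the control of the increments over the mesh to all
    times, at the price of one mesh on either side. *)
Lemma regular_path lam a e n X w s t : poisson_process P lam X ->
  0 < lam -> 0 < a -> 0 < e -> e <= 1 -> ~ irregular lam a e n X w ->
  0 <= s -> s <= t -> t < a * n%:R ->
  `|(X t w)%:R - (X s w)%:R - lam * (t - s)| <= e * lam * (t - s) + 4 * lam * a.
Proof.
move=> pX lam0 a0 e0 e1 reg s0 st tn; have [_ _ mono _ _ _] := pX.
pose x t := (X t w)%:R : R.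
have xm u v : 0 <= u -> u <= v -> x u <= x v by move=> u0 uv; rewrite ler_nat mono.
have am m : 0 <= a * m%:R by rewrite mulr_ge0// ltW.
have stp m : (m < n)%N ->
    `|x (a * m.+1%:R) - x (a * m%:R) - lam * a| <= e * (lam * a).
  move=> mn; rewrite leNgt; apply/negP => H; apply: reg.
  rewrite /irregular -bigcup_mkord; exists m => //=.
  rewrite /irregular_step/= natrB//; apply: mono => //.
  by rewrite ler_pM2l// ler_nat.
have grid k m : (m + k <= n)%N ->
    `|x (a * (m + k)%:R) - x (a * m%:R) - lam * a * k%:R| <= e * (lam * a) * k%:R.
  elim: k => [|k ih] mk.
    by rewrite addn0 !mulr0 subrr subr0 normr0.
  rewrite addnS in mk *; have a1 := stp _ mk; have a2 := ih (ltnW mk).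
  have -> : x (a * (m + k).+1%:R) - x (a * m%:R) - lam * a * k.+1%:R =
    (x (a * (m + k)%:R) - x (a * m%:R) - lam * a * k%:R) +
    (x (a * (m + k).+1%:R) - x (a * (m + k)%:R) - lam * a).
    by rewrite -[X in lam * a * X]natr1; ring.
  have -> : e * (lam * a) * k.+1%:R = e * (lam * a) * k%:R + e * (lam * a).
    by rewrite -natr1; ring.
  by apply: le_trans (ler_normD _ _) _; exact: lerD.
have t0 : 0 <= t by exact: le_trans st.
have fl u : 0 <= u -> exists m, a * m%:R <= u /\ u < a * m.+1%:R.
  move=> u0; exists (Num.truncn (u / a)).
  have /andP[] := truncn_itv (divr_ge0 u0 (ltW a0)).
  by rewrite ler_pdivlMr// ltr_pdivrMr// ![_ * a]mulrC.
have [ms [ms1 ms2]] := fl s s0; have [mt [mt1 mt2]] := fl t t0.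
have mst : (ms <= mt)%N.
  rewrite -ltnS -(@ltr_nat R) -(ltr_pM2l a0).
  by apply: le_lt_trans mt2; apply: le_trans st.
have mtn : (mt < n)%N.
  by rewrite -(@ltr_nat R) -(ltr_pM2l a0); apply: le_lt_trans tn.
have la0 : 0 < lam * a by rewrite mulr_gt0.
rewrite -/(x t) -/(x s).
have up : x t - x s <= (1 + e) * lam * (t - s + 2 * a).
  have := grid (mt.+1 - ms)%N ms; rewrite subnKC ?(leq_trans mst)// => /(_ mtn).
  rewrite ler_norml => /andP[_ h].
  have h1 := xm t (a * mt.+1%:R) t0 (ltW mt2).
  have h2 := xm (a * ms%:R) s (am ms) ms1.
  have h3 : a * (mt.+1 - ms)%:R <= t - s + 2 * a.
    rewrite natrB ?(leq_trans mst)// mulrBr -natr1 mulrDr mulr1.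
    by move: ms2; rewrite -natr1 mulrDr mulr1; lra.
  have h4 : (1 + e) * lam * (a * (mt.+1 - ms)%:R) <= (1 + e) * lam * (t - s + 2 * a).
    by rewrite ler_pM2l// mulr_gt0//; lra.
  lra.
have lo : (1 - e) * lam * (t - s - 2 * a) <= x t - x s.
  have [tsa|tsa] := leP (t - s) (2 * a).
    apply: (@le_trans _ _ 0); last by rewrite subr_ge0 xm.
    by rewrite mulr_ge0_le0 ?mulr_ge0 ?(ltW lam0)//; lra.
  have mst2 : (ms.+1 <= mt)%N.
    rewrite -(ler_nat R) -(ler_pM2l a0) -natr1 mulrDr mulr1.
    by move: mt2; rewrite -natr1 mulrDr mulr1; lra.
  have := grid (mt - ms.+1)%N ms.+1; rewrite subnKC// => /(_ (ltnW mtn)).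
  rewrite ler_norml => /andP[h _].
  have h1 := xm (a * mt%:R) t (am mt) mt1.
  have h2 := xm s (a * ms.+1%:R) s0 (ltW ms2).
  have h3 : t - s - 2 * a <= a * (mt - ms.+1)%:R.
    rewrite natrB// mulrBr.
    by move: ms1 mt2; rewrite -!natr1 !mulrDr !mulr1; lra.
  have h4 : (1 - e) * lam * (t - s - 2 * a) <= (1 - e) * lam * (a * (mt - ms.+1)%:R).
    by rewrite ler_wpM2l// mulr_ge0//; lra.
  lra.
have ela : e * lam * a <= lam * a.
  by rewrite -mulrA -[leRHS]mul1r ler_pM2r.
have ela0 : 0 <= e * lam * a by rewrite !mulr_ge0 ?(ltW e0) ?(ltW lam0) ?(ltW a0).
rewrite ler_norml; apply/andP; split; lra.
Qed.

End Regularity.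

(** * Regularity of the flow count paths *)

Section LowerIntegral.
Local Open Scope classical_set_scope.
Local Open Scope ring_scope.

(** The integral of a nonnegative function is a supremum over the simple functions
    below it, hence monotone even without measurability. This breaks a circle: the
    cumulative allocation is seen to be monotone before the path that drives it is
    known to be measurable in time. *)
Lemma ge0_integral_mono d (T : measurableType d) (R : realType)
    (m : {measure set T -> \bar R}) (D D' : set T) (f g : T -> \bar R) :
  (forall x, D x -> 0 <= f x)%E -> (forall x, D' x -> 0 <= g x)%E ->
  (forall x, (f \_ D) x <= (g \_ D') x)%E ->
  (\int[m]_(x in D) f x <= \int[m]_(x in D') g x)%E.
Proof.
move=> f0 g0 fg; rewrite !ge0_integralE//.
apply: ereal_sup_le => _ [h hf <-]; exists h => // x.
exact: le_trans (hf x) (fg x).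
Qed.

End LowerIntegral.

Section CountingPath.
Context {R : realType} {nI : nat}.
Local Open Scope classical_set_scope.
Local Open Scope ring_scope.
Context (E S n : 'I_nI -> R -> nat) (g : 'cV[R]_nI -> 'cV[R]_nI) (cap : R).
Context (E_mono : forall i s t, 0 <= s -> s <= t -> (E i s <= E i t)%N).
Context (S_mono : forall i s t, 0 <= s -> s <= t -> (S i s <= S i t)%N).
Context (g_bounds : forall x : 'cV[R]_nI, (forall i, 0 <= x i 0) ->
  forall i, 0 <= g x i 0 <= cap).
Context (cap_ge0 : 0 <= cap).

Let rate i (u : R) := g (\col_i (n i u)%:R) i 0.
Let T i (t : R) := \int[lebesgue_measure]_(s in `[0, t]) rate i s.

Context (dynamics : forall i t, 0 <= t ->
  (n i t)%:R = (n i 0)%:R + (E i t)%:R - (S i (T i t))%:R :> R).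

Let rate_bounds i u : 0 <= rate i u <= cap.
Proof. by apply: g_bounds => k; rewrite mxE. Qed.

Let rate_ge0 i u : 0 <= rate i u. Proof. by have /andP[] := rate_bounds i u. Qed.

Let T_fin i (t : R) : (\int[lebesgue_measure]_(s in `[0%R, t]) (rate i s)%:E)%E \is a fin_num.
Proof.
rewrite ge0_fin_numE; last by apply: integral_ge0 => x _; rewrite lee_fin.
apply: (@le_lt_trans _ _ (\int[lebesgue_measure]_(s in `[0%R, t]) cap%:E)%E).
  apply: ge0_integral_mono => [x _|x _|x]; rewrite ?lee_fin//.
  by rewrite /patch; case: ifP => // _; rewrite lee_fin; have /andP[] := rate_bounds i x.
rewrite integral_cst//= lebesgue_measure_itv/=; case: ifP => _.
  by rewrite -EFinB -EFinM ltry.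
by rewrite mule0.
Qed.

Let T_ge0 i t : 0 <= T i t.
Proof. exact: Rintegral_ge0. Qed.

Let T_mono i s t : s <= t -> T i s <= T i t.
Proof.
move=> st; rewrite /T /Rintegral fine_le ?T_fin//.
apply: ge0_integral_mono => [x _|x _|x]; rewrite ?lee_fin//.
rewrite /patch; case: ifPn => [xs|_].
  rewrite ifT//; move: xs; rewrite !inE/= !in_itv/= => /andP[-> /le_trans]; exact.
by case: ifP => // _; rewrite lee_fin.
Qed.

Let state (u : R) : {ffun 'I_nI -> nat} := [ffun i => n i (Num.max u 0)].

(** By the dynamics the path is a difference of monotone functions of time. *)
Let state_fiber v : measurable [set u | state u = v].
Proof.
pose h i (u : R) : R := (n i 0)%:R + (E i (Num.max u 0))%:R - (S i (T i (Num.max u 0)))%:R.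
have mh i : measurable_fun setT (h i).
  have max_mono (u u' : R) : u <= u' -> Num.max u 0 <= Num.max u' 0.
    by move=> uv; rewrite ge_max !le_max uv lexx !orbT.
  have max0 (u : R) : 0 <= Num.max u 0 by rewrite le_max lexx orbT.
  apply: measurable_funB; apply: nondecreasing_measurable => // u u' uv.
    by rewrite lerD2l ler_nat E_mono// max_mono.
  by rewrite ler_nat S_mono// T_mono// max_mono.
have -> : [set u | state u = v] =
    \bigcap_(i in [set: 'I_nI]) (h i @^-1` [set (v i)%:R]).
  apply/seteqP; split=> u /= => [<- i _|H].
    rewrite /h ffunE; apply/esym/dynamics.
    by rewrite le_max lexx orbT.
  apply/ffunP => i; rewrite ffunE; apply/eqP; rewrite -(eqr_nat R).
  by rewrite dynamics ?le_max ?lexx ?orbT//; apply/eqP; exact: H.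
apply: fin_bigcap_measurable; first exact: finite_finset.
move=> i _; rewrite -[X in measurable X]setTI; exact: mh.
Qed.

Let rate_measurable i (t : R) : measurable_fun `[0, t] (rate i).
Proof.
pose G v := g (\col_i (v i)%:R) i 0.
have mG : measurable_fun setT (G \o state).
  move=> _ Y _; rewrite setTI; exact: (fiber_measurable state_fiber (G @^-1` Y)).
apply: (@eq_measurable_fun _ _ _ _ _ (G \o state)).
  move=> u; rewrite inE/= in_itv/= => /andP[u0 _]; rewrite /G/= /rate; congr (g _ _ _).
  by apply/matrixP => k l; rewrite !mxE ffunE (max_idPl u0).
exact: measurable_funTS.
Qed.

Let rate_integrable i (t : R) :
  lebesgue_measure.-integrable `[0, t] (EFin \o rate i).
Proof.
apply: measurable_bounded_integrable => //.
  by rewrite /= lebesgue_measure_itv/=; case: ifP => // _; rewrite -EFinB ltry.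
  exact: rate_measurable.
exists cap; split=> [|M capM x _]; first exact: num_real.
apply: le_trans (ltW capM).
by rewrite ger0_norm//; have /andP[] := rate_bounds i x.
Qed.

Lemma cumulative_integrates (U : R) : integrates U rate T.
Proof.
move=> b K s t s0 st tU bK.
have t0 : 0 <= t by exact: le_trans st.
have sub : [set` `]s, t]] `<=` [set` `[0, t]].
  move=> x /=; rewrite !in_itv/= => /andP[sx ->]; rewrite andbT.
  by apply: le_trans s0 (ltW sx).
have int i : lebesgue_measure.-integrable `]s, t] (EFin \o rate i).
  by apply: integrableS (rate_integrable i t) => //.
have TB i : T i t - T i s = \int[lebesgue_measure]_(u in `]s, t]) rate i u.
  by rewrite /T Rintegral_itvB.
have [sumE sumI] : \sum_i b i * (T i t - T i s) =
    \int[lebesgue_measure]_(u in `]s, t]) (\sum_i b i * rate i u) /\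
    lebesgue_measure.-integrable `]s, t] (EFin \o (fun u => \sum_i b i * rate i u)).
  elim: (index_enum _) => [|i r [ih1 ih2]].
    split.
      rewrite big_nil; under eq_Rintegral do rewrite big_nil.
      by rewrite Rintegral_cst// mul0r.
    rewrite (_ : EFin \o _ = cst (0 : \bar R)); first exact: integrable0.
    by apply/funext => u /=; rewrite big_nil.
  have intb : lebesgue_measure.-integrable `]s, t] (EFin \o (fun u => b i * rate i u)).
    rewrite (_ : EFin \o _ = (fun u => (b i)%:E * (EFin \o rate i) u)%E).
      exact: integrableZl.
    by apply/funext => u /=; rewrite EFinM.
  split.
    rewrite big_cons; under eq_Rintegral do rewrite big_cons.
    by rewrite RintegralD// RintegralZl// ih1 TB.
  pose f1 := EFin \o (fun u : R => b i * rate i u).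
  pose f2 := EFin \o (fun u : R => \sum_(j <- r) b j * rate j u).
  rewrite (_ : EFin \o _ = (f1 \+ f2)%E); first exact: integrableD.
  by apply/funext => u /=; rewrite big_cons EFinD.
rewrite sumE; apply: (@le_trans _ _ (\int[lebesgue_measure]_(u in `]s, t]) K)).
  apply: le_Rintegral => //.
    apply: measurable_bounded_integrable => //.
      by rewrite /= lebesgue_measure_itv/=; case: ifP => // _; rewrite -EFinB ltry.
    by exists `|K|; split; [exact: num_real | move=> M KM x _; exact: ltW].
  move=> u /=; rewrite in_itv/= => /andP[su ut]; exact: bK (ltW su) ut.
rewrite Rintegral_cst//= lebesgue_measure_itv/= lte_fin.
case: ifP => [_|/negbT]; first by rewrite -EFinB.
by rewrite -leNgt => ts; rewrite mulr0 (le_anti (_ : s <= t <= s)) ?subrr ?mulr0// st ts.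
Qed.

Lemma cumulative_lipschitz i (s t : R) : 0 <= s -> s <= t ->
  0 <= T i t - T i s <= cap * (t - s).
Proof.
move=> s0 st; exact: (integrates_coord (@cumulative_integrates t)).
Qed.

Context (E_right : forall i t, 0 <= t -> E i s @[s --> t^'+] --> E i t).
Context (S_right : forall i t, 0 <= t -> S i s @[s --> t^'+] --> S i t).

Let right_constant (X : R -> nat) (t : R) : X s @[s --> t^'+] --> X t ->
  exists d, 0 < d /\ forall s, t <= s -> s < t + d -> X s = X t.
Proof.
move=> /(_ [set X t] (discrete_set1 _)) [d /= d0 Hd]; exists d; split=> // s.
rewrite le_eqVlt => /predU1P[<-//|ts] sd; apply: Hd => //=.
by rewrite ltr0_norm ?subr_lt0//; lra.
Qed.

(** The cumulative allocation is Lipschitz and monotone, so composing with it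
    preserves right continuity. *)
Lemma path_right_constant (t : R) : 0 <= t -> exists2 d, 0 < d &
  forall s i, t <= s -> s < t + d -> n i s = n i t.
Proof.
move=> t0.
have h i : exists d, 0 < d /\ forall s, t <= s -> s < t + d -> n i s = n i t.
  have [d1 [d10 H1]] := right_constant (@E_right i t t0).
  have [d2 [d20 H2]] := right_constant (@S_right i _ (T_ge0 i t)).
  have c1 : 0 < cap + 1 by rewrite ltr_wpDl.
  exists (Num.min d1 (d2 / (cap + 1))); split=> [|s ts]; first by rewrite lt_min d10 divr_gt0.
  rewrite addr_minr lt_min => /andP[sd1 sd2].
  apply/eqP; rewrite -(eqr_nat R) (dynamics i (le_trans t0 ts)) [X in _ == X](dynamics i t0).
  rewrite H1// H2//.
    exact: T_mono.
  have /andP[_] := cumulative_lipschitz i t0 ts.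
  have : s - t < d2 / (cap + 1) by lra.
  rewrite ltr_pdivlMr//; lra.
have [f fP] := choice h.
have f0 i : 0 < f i by have [] := fP i.
have [e e0 ef] := finite_lower_bound f0.
exists e => // s i ts se; have [_] := fP i; apply=> //.
by apply: lt_le_trans se _; rewrite lerD2l.
Qed.

End CountingPath.

(** * Measurability of running suprema *)

Section RunningSupremum.
Context {R : realType} {d : measure_display} {Omega : measurableType d}.
Context {I : finType}.
Local Open Scope classical_set_scope.
Local Open Scope ring_scope.
Context (N : I -> R -> Omega -> nat).
Context (N_fiber : forall i t m, 0 <= t -> measurable [set w | N i t w = m]).
Context (N_right : forall w t, 0 <= t -> exists2 e, 0 < e &
  forall s i, t <= s -> s < t + e -> N i s w = N i t w).
Context (N_bounded : forall w (U : R), exists b : nat,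
  forall t i, 0 <= t -> t <= U -> (N i t w <= b)%N).

Definition path_state (t : R) w : {ffun I -> nat} := [ffun i => N i t w].

Lemma path_state_fiber t v : 0 <= t -> measurable [set w | path_state t w = v].
Proof.
move=> t0; have -> : [set w | path_state t w = v] =
    \bigcap_(i in [set: I]) [set w | N i t w = v i].
  apply/seteqP; split=> w /= => [<- i _|H]; first by rewrite /= ffunE.
  by apply/ffunP => i; rewrite ffunE; exact: H.
by apply: fin_bigcap_measurable => [|i _]; [exact: finite_finset | exact: N_fiber].
Qed.

(** By right continuity a state is visited at the end point or at a rational time. *)
Lemma visit_measurable (U : R) v : 0 <= U ->
  measurable [set w | exists t, [/\ 0 <= t, t <= U & path_state t w = v]].
Proof.
move=> U0; have -> : [set w | exists t, [/\ 0 <= t, t <= U & path_state t w = v]] =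
    [set w | path_state U w = v] `|` \bigcup_(q : rat)
      (if (0 <= ratr q :> R) && (ratr q <= U) then [set w | path_state (ratr q) w = v]
       else set0).
  apply/seteqP; split=> w /=.
    move=> [t [t0 tU tv]]; have [tU'|tU'] := eqVneq t U; first by left; rewrite -tU'.
    have {tU'}tU : t < U by rewrite lt_neqAle tU'.
    have [e e0 He] := N_right w t0.
    have : t < Num.min (t + e) U by rewrite lt_min tU ltrDl e0.
    move=> /rat_in_itvoo[q]; rewrite in_itv/= lt_min => /and3P[tq qe qU].
    right; exists q => //=; rewrite ifT; last by rewrite (ltW qU) (le_trans t0 (ltW tq)).
    rewrite /= -tv; apply/ffunP => i; rewrite !ffunE; exact: He (ltW tq) qe.
  move=> [Uv|[q _]]; first by exists U.
  by case: ifP => //= /andP[q0 qU] qv; exists (ratr q).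
apply: measurableU; first exact: path_state_fiber.
apply: countable_bigcupT_measurable => [|q]; first exact: countableP.
by case: ifP => // /andP[q0 _]; exact: path_state_fiber.
Qed.

(** A bounded path in the lattice has finitely many values. *)
Lemma path_values_bounded (f : {ffun I -> nat} -> R) (U : R) w :
  exists M : R, forall t, 0 <= t -> t <= U -> f (path_state t w) <= M.
Proof.
have [b Hb] := N_bounded w U.
pose c (v : {ffun I -> 'I_b.+1}) : {ffun I -> nat} := [ffun i => nat_of_ord (v i)].
exists (\sum_(v : {ffun I -> 'I_b.+1}) `|f (c v)|) => t t0 tU.
pose v : {ffun I -> 'I_b.+1} := [ffun i => inord (N i t w)].
have -> : path_state t w = c v.
  by apply/ffunP => i; rewrite !ffunE inordK// ltnS; exact: Hb.
rewrite (bigD1 v)//=; apply: le_trans (ler_norm _) _.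
by rewrite lerDl sumr_ge0.
Qed.

(** The supremum exceeds [a] when some state at which [f] exceeds [a] is visited,
    and there are countably many states. *)
Lemma running_sup_measurable (f : {ffun I -> nat} -> R) (U : R) : 0 <= U ->
  measurable_fun setT (fun w => sup [set f (path_state t w) | t in `[0, U]]).
Proof.
move=> U0; apply: (measurability (@RGenOInfty.G R)) => [|/= _ [_] [a] -> <-].
  exact: RGenOInfty.measurableE.
rewrite setTI.
pose visit v := [set w | exists t, [/\ 0 <= t, t <= U & path_state t w = v]].
have -> : (fun w => sup [set f (path_state t w) | t in `[0, U]]) @^-1` `]a, +oo[ =
    \bigcup_(v : {ffun I -> nat}) (if a < f v then visit v else set0).
  apply/seteqP; split=> w /=.
    rewrite in_itv/= andbT => sa; apply: contrapT => nov.
    move: sa; rewrite ltNge => /negP; apply; apply: ge_sup.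
      by exists (f (path_state 0 w)); exists 0 => //=; rewrite in_itv/= lexx.
    move=> _ [t /= + <-]; rewrite in_itv/= => /andP[t0 tU].
    rewrite leNgt; apply/negP => fa; apply: nov; exists (path_state t w) => //.
    by rewrite fa; exists t.
  move=> [v _]; case: ifP => // av [t [t0 tU tv]]; rewrite in_itv/= andbT.
  apply: lt_le_trans av _; apply: ub_le_sup.
    have [M HM] := path_values_bounded f U w.
    by exists M => _ [s /= + <-]; rewrite in_itv/= => /andP[]; exact: HM.
  by exists t; rewrite /= ?in_itv/= ?t0// tv.
apply: countable_bigcupT_measurable => [|v]; first exact: countableP.
by case: ifP => // _; exact: visit_measurable.
Qed.

End RunningSupremum.

(** * Collapse on a regular path *)

Section FluidError.
Local Open Scope classical_set_scope.
Local Open Scope ring_scope.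

(** Arrivals and departures deviate from their means, and the rates from their
    limits, each by a proportion [sigma]. *)
Lemma fluid_error {R : realType} (sigma h l r B cap nu nu' mu mu' tau dE dS dT : R) :
  0 <= sigma -> 0 <= r -> r <= l -> 0 <= tau -> tau <= h * l ->
  0 <= cap -> 0 <= dT -> dT <= cap * tau ->
  0 <= nu' -> nu' <= B -> 0 <= mu' -> mu' <= B ->
  `|nu' - nu| <= sigma -> `|mu' - mu| <= sigma ->
  `|dE - nu' * tau| <= sigma * nu' * tau + 4 * nu' * (sigma * r) ->
  `|dS - mu' * dT| <= sigma * mu' * dT + 4 * mu' * (sigma * r) ->
  `|dE - dS - (nu * tau - mu * dT)| <=
    sigma * ((B + B * cap + 1 + cap) * h + 8 * B) * l.
Proof.
move=> s0 r0 rl t0 th cap0 dT0 dT1 nu0 nuB mu0 muB nuc muc HE HS.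
have B0 : 0 <= B by exact: le_trans nuB.
have -> : dE - dS - (nu * tau - mu * dT) = (dE - nu' * tau) - (dS - mu' * dT) +
  ((nu' - nu) * tau - (mu' - mu) * dT) by ring.
have sr0 : 0 <= sigma * r by rewrite mulr_ge0.
have b1 : sigma * nu' * tau <= sigma * (B * tau).
  by rewrite -mulrA ler_wpM2l// ler_wpM2r.
have b2 : 4 * nu' * (sigma * r) <= 4 * B * (sigma * r) by rewrite ler_wpM2r// ler_wpM2l.
have b3 : sigma * mu' * dT <= sigma * (B * (cap * tau)).
  by rewrite -mulrA ler_wpM2l// ler_pM.
have b4 : 4 * mu' * (sigma * r) <= 4 * B * (sigma * r) by rewrite ler_wpM2r// ler_wpM2l.
have b5 : `|(nu' - nu) * tau| <= sigma * tau.
  by rewrite normrM (ger0_norm t0) ler_wpM2r.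
have b6 : `|(mu' - mu) * dT| <= sigma * (cap * tau).
  by rewrite normrM (ger0_norm dT0) ler_pM.
have b7 : sigma * ((B + B * cap + 1 + cap) * tau) <=
    sigma * ((B + B * cap + 1 + cap) * (h * l)).
  by rewrite ler_wpM2l// ler_wpM2l// !addr_ge0// mulr_ge0.
have b8 : 8 * B * (sigma * r) <= 8 * B * (sigma * l).
  by rewrite ler_wpM2l ?mulr_ge0// ler_wpM2l.
apply: le_trans (ler_normD _ _) _.
apply: le_trans (lerD (ler_normB _ _) (ler_normB _ _)) _.
apply: le_trans (lerD (lerD HE HS) (lerD b5 b6)) _; lra.
Qed.

End FluidError.

Section OneSystem.
Context {R : realType} {nJ nI : nat}.
Local Open Scope classical_set_scope.
Local Open Scope ring_scope.
Context (A : 'M[R]_(nJ, nI)) (nu mu kappa : 'cV[R]_nI) (alpha : R).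
Context (A01 : forall j i, A j i = 0 \/ A j i = 1).
Context (Arow : forall j, exists i, A j i = 1).
Context (nu_gt0 : forall i, 0 < nu i 0) (mu_gt0 : forall i, 0 < mu i 0).
Context (kappa_gt0 : forall i, 0 < kappa i 0) (alpha_gt0 : 0 < alpha).
Context (C : 'cV[R]_nJ) (Acol : forall i, exists j, A j i = 1).
Context (heavy : forall j, \sum_i A j i * (nu i 0 / mu i 0) = C j 0).

Let cap := \sum_j C j 0.

Let cap_ge0 : 0 <= cap.
Proof. exact: (capacity_sum_ge0 A01 nu_gt0 mu_gt0 heavy). Qed.

Let rate_bounds (x : 'cV[R]_nI) : (forall i, 0 <= x i 0) ->
  forall i, 0 <= bandwidth A C kappa alpha x i 0 <= cap.
Proof.
exact: (allocation_bounds A01 nu_gt0 mu_gt0 kappa_gt0 alpha_gt0 Acol heavy).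
Qed.

Lemma workloadE (m n : 'cV[R]_nI) j : (forall i, 0 < m i 0) ->
  workload A m n j 0 = \sum_i A j i * (n i 0 / m i 0).
Proof.
move=> m0; pose D := diag_mx (\row_i (m i 0)^-1).
have DE : D *m diag_mx m^T = 1%:M.
  apply/matrixP => i k; rewrite mul_diag_mx !mxE; case: eqP => [->|_].
    by rewrite !mulr1n mulVf// gt_eqF.
  by rewrite !mulr0n mulr0.
have [_ uD] := mulmx1_unit DE.
rewrite /workload; have -> : invmx (diag_mx m^T) = D.
  by rewrite -[LHS]mul1mx -DE -mulmxA mulmxV// mulmx1.
rewrite -mulmxA mxE; apply: eq_bigr => i _.
by rewrite mul_diag_mx !mxE; ring.
Qed.

Lemma workloadZ (m n : 'cV[R]_nI) (c : R) :
  workload A m (c *: n) = c *: workload A m n.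
Proof. by rewrite /workload -scalemxAr. Qed.

Section Path.
Context {d : measure_display} {Omega : measurableType d} (P : probability Omega R).
Context (nu' mu' : 'cV[R]_nI) (E S N : 'I_nI -> R -> Omega -> nat).
Context (model : flow_level_model P A C kappa alpha nu' mu' E S N).

Let E_mono w i s t : 0 <= s -> s <= t -> (E i s w <= E i t w)%N.
Proof. by have [_ _ + _ _ _] := model_arrivals model i; apply. Qed.

Let S_mono w i s t : 0 <= s -> s <= t -> (S i s w <= S i t w)%N.
Proof. by have [_ _ + _ _ _] := model_services model i; apply. Qed.

Lemma model_integrates w (U : R) :
  integrates U (fun i u => bandwidth A C kappa alpha (counts N u w) i 0)
    (fun i t => cumulative_bandwidth A C kappa alpha N i t w).
Proof.
apply: (@cumulative_integrates R nI (fun i t => E i t w) (fun i t => S i t w)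
  (fun i t => N i t w) (bandwidth A C kappa alpha) cap).
- exact: E_mono.
- exact: S_mono.
- exact: rate_bounds.
- exact: cap_ge0.
- move=> i t t0; refine (model_dynamics model i w t0).
Qed.

Lemma model_lipschitz w i (s t : R) : 0 <= s -> s <= t ->
  0 <= cumulative_bandwidth A C kappa alpha N i t w -
       cumulative_bandwidth A C kappa alpha N i s w <= cap * (t - s).
Proof.
move=> s0 st; apply: (integrates_coord (@model_integrates w t)) => // u _ _.
by apply: rate_bounds => k; rewrite mxE.
Qed.

Lemma model_right_constant w (t : R) : 0 <= t -> exists2 e, 0 < e &
  forall s i, t <= s -> s < t + e -> N i s w = N i t w.
Proof.
apply: (@path_right_constant R nI (fun i t => E i t w) (fun i t => S i t w)
  (fun i t => N i t w) (bandwidth A C kappa alpha) cap).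
- exact: E_mono.
- exact: S_mono.
- exact: rate_bounds.
- exact: cap_ge0.
- move=> i s s0; refine (model_dynamics model i w s0).
- by move=> i s s0; have [_ _ _ + _ _] := model_arrivals model i; exact.
- by move=> i s s0; have [_ _ _ + _ _] := model_services model i; exact.
Qed.

Lemma model_bounded w (U : R) : exists b : nat,
  forall t i, 0 <= t -> t <= U -> (N i t w <= b)%N.
Proof.
exists (\sum_i (N i 0%R w + E i U w))%N => t i t0 tU.
apply: (@leq_trans (N i 0 w + E i U w)).
  rewrite -(ler_nat R) (model_dynamics model i w t0) natrD.
  have : (E i t w)%:R <= (E i U w)%:R :> R by rewrite ler_nat E_mono.
  have := ler0n R (S i (cumulative_bandwidth A C kappa alpha N i t w) w).
  lra.
by rewrite (bigD1 i)//= leq_addr.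
Qed.

Lemma model_fiber i t m : 0 <= t -> measurable [set w | N i t w = m].
Proof.
move=> t0; rewrite (_ : [set _ | _] = setT `&` N i t @^-1` [set m]).
  exact: (model_measurable model).
by rewrite setTI.
Qed.

End Path.


Lemma norm_sum_le (I : finType) (f g : I -> R) :
  (forall i, `|f i| <= g i) -> `|\sum_i f i| <= \sum_i g i.
Proof. by move=> fg; apply: le_trans (ler_norm_sum _ _ _) _; exact: ler_sum. Qed.

Lemma workload_close (e : R) (mu' x : 'cV[R]_nI) j :
  (forall i, 0 < mu' i 0) -> (forall i, `|(mu' i 0)^-1 - (mu i 0)^-1| <= e) ->
  (forall i, 0 <= x i 0 <= 1) ->
  `|workload A mu' x j 0 - limit_workload A mu x j 0| <= nI%:R * e.
Proof.
move=> mu'0 inv_close xB; rewrite workloadE// mxE -sumrB.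
have -> : nI%:R * e = \sum_(i < nI) e by rewrite sumr_const card_ord mulr_natl.
apply: norm_sum_le => i.
have -> : A j i * (x i 0 / mu' i 0) - A j i * (x i 0 / mu i 0) =
  A j i * x i 0 * ((mu' i 0)^-1 - (mu i 0)^-1) by ring.
have /andP[x0 x1] := xB i.
rewrite normrM -[leRHS]mul1r; apply: ler_pM => //.
rewrite normrM (ger0_norm x0).
by case: (A01 j i) => ->; rewrite ?normr0 ?mul0r// normr1 mul1r.
Qed.

(** Dividing by [l = r * M], where [M] bounds the path, puts the states in the unit
    box without any control on [M]: this is why the collapse is multiplicative. As
    [M] is at least 1, errors of order [sigma * r] stay of order [sigma]. *)
Lemma collapse_on_regular_paths (dist : R) : 0 < dist ->
  exists sigma ei : R, [/\ 0 < sigma, sigma <= 1, 0 < ei &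
  forall (d : measure_display) (Omega : measurableType d) (P : probability Omega R)
    (nu' mu' : 'cV[R]_nI) (E S N : 'I_nI -> R -> Omega -> nat) (r T : R) (n : nat)
    (w : Omega),
  flow_level_model P A C kappa alpha nu' mu' E S N ->
  0 < r -> 0 < T ->
  (forall i, 0 < nu' i 0) -> (forall i, 0 < mu' i 0) ->
  (forall i, `|nu' i 0 - nu i 0| <= sigma) ->
  (forall i, `|mu' i 0 - mu i 0| <= sigma) ->
  (forall i, `|(mu' i 0)^-1 - (mu i 0)^-1| <= sigma) ->
  (1 + cap) * (r ^+ 2 * T) < sigma * r * n%:R ->
  (forall i, ~ irregular (nu' i 0) (sigma * r) sigma n (E i) w) ->
  (forall i, ~ irregular (mu' i 0) (sigma * r) sigma n (S i) w) ->
  (forall i, `|(diffusion r N 0 w - lifting A nu mu kappa alpha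
     (workload A mu' (diffusion r N 0 w))) i 0| <= ei) ->
  forall M, 1 <= M ->
  (forall t, 0 <= t -> t <= T -> forall i, diffusion r N t w i 0 <= M) ->
  forall t, 0 <= t -> t <= T -> forall i,
    `|(diffusion r N t w - lifting A nu mu kappa alpha
     (workload A mu' (diffusion r N t w))) i 0| <= dist * M].
Proof.
move=> dist0.
have [eg eg0 Hg] := gap_small A01 Arow nu_gt0 mu_gt0 kappa_gt0 alpha_gt0 dist0.
have [e [h [e0 h0 He]]] := gap_stays_small A01 Arow nu_gt0 mu_gt0 kappa_gt0
  alpha_gt0 Acol heavy eg0.
have eg20 : 0 < eg / 2 by lra.
have [ei ei0 Hi] := gap_initial A01 Arow nu_gt0 mu_gt0 kappa_gt0 alpha_gt0 eg20.
pose B := \sum_i (nu i 0 + mu i 0) + 1.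
have [nu0 mu0] : (forall i, 0 <= nu i 0) /\ (forall i, 0 <= mu i 0).
  by split=> i; exact: ltW.
have sum0 : 0 <= \sum_i (nu i 0 + mu i 0) by apply: sumr_ge0 => i _; rewrite addr_ge0.
have B0 : 0 <= B by rewrite /B; lra.
(* total error, per unit of [sigma], over a window of length [h] *)
pose Q := (B + B * cap + 1 + cap) * h + 8 * B.
have Q0 : 0 <= Q.
  by rewrite /Q addr_ge0// mulr_ge0 ?(ltW h0)// !addr_ge0// mulr_ge0.
have [sigma [s0 s1 sQ seg sei]] : exists sigma, [/\ 0 < sigma, sigma <= 1,
    sigma * Q <= e, nI%:R * sigma <= eg & nI%:R * sigma <= ei].
  exists (Num.min 1 (Num.min (e / (Q + 1)) (Num.min (eg / (nI%:R + 1)) (ei / (nI%:R + 1))))).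
  set sigma := Num.min _ _.
  have n0 : 0 < nI%:R + 1 :> R by rewrite ltr_wpDl.
  have Q1 : 0 < Q + 1 by lra.
  have sg0 : 0 < sigma by rewrite !lt_min ltr01 !divr_gt0.
  have bnd (c K : R) : 0 <= K -> sigma <= c / (K + 1) -> K * sigma <= c.
    move=> K0; rewrite ler_pdivlMr; last by lra.
    by apply: le_trans; rewrite mulrC ler_wpM2l ?(ltW sg0)//; lra.
  split=> //; first by rewrite ge_min lexx.
  - by rewrite mulrC; apply: bnd => //; rewrite !ge_min lexx !orbT.
  - by apply: bnd; rewrite // !ge_min lexx !orbT.
  - by apply: bnd; rewrite // !ge_min lexx !orbT.
exists sigma, ei; split=> // d Omega P nu' mu' E S N r T n w model r0 T0 nu'0 mu'0.
move=> nuc muc invc hor regE regS init M M1 Mb.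
have M0 : 0 < M by lra.
pose l := r * M; have l0 : 0 < l by rewrite mulr_gt0.
pose X u : 'cV[R]_nI := l^-1 *: counts N u w.
pose U := r ^+ 2 * T; have r20 : 0 < r ^+ 2 by rewrite exprn_gt0.
have XD t : X (r ^+ 2 * t) = M^-1 *: diffusion r N t w.
  by rewrite /X /diffusion scalerA invfM mulrC.
have Xcounts u : l *: X u = counts N u w.
  by rewrite scalerA mulfV ?scale1r// gt_eqF.
have XB u : 0 <= u -> u <= U -> forall i, 0 <= X u i 0 <= 1.
  move=> u0 uU i.
  have -> : u = r ^+ 2 * (u / r ^+ 2) by rewrite mulrC divfK// gt_eqF.
  rewrite XD mxE; apply/andP; split.
    by rewrite mulr_ge0 ?invr_ge0 ?(ltW M0)// !mxE mulr_ge0// invr_ge0 ltW.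
  rewrite ler_pdivrMl// mulr1; apply: Mb; first by rewrite divr_ge0// ltW.
  by rewrite ler_pdivrMr// mulrC.
have U0 : 0 <= U by rewrite mulr_ge0// ltW.
pose Tc i t := cumulative_bandwidth A C kappa alpha N i t w.
have Tc0 i : Tc i 0 = 0.
  by rewrite /Tc /cumulative_bandwidth set_itv1 Rintegral_set1.
have dTc i s' t' := model_lipschitz model w i (s := s') (t := t').
have lU : cap * U + U < sigma * r * n%:R.
  by apply: le_lt_trans hor; rewrite mulrDl mul1r addrC.
have Tc_ge0 i u : 0 <= u -> 0 <= Tc i u.
  by move=> u0; have := dTc i 0 u (lexx _) u0; rewrite -/(Tc i 0) Tc0 subr0 => /andP[].
have Tc_lt i u : 0 <= u -> u <= U -> Tc i u < sigma * r * n%:R.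
  move=> u0 uU; apply: le_lt_trans lU.
  have := dTc i 0 u (lexx _) u0; rewrite -/(Tc i 0) Tc0 !subr0 => /andP[_ H].
  apply: le_trans H _; apply: (@le_trans _ _ (cap * U)); first by rewrite ler_wpM2l.
  by rewrite lerDl.
have rl : r <= l by rewrite -[leLHS]mulr1 ler_pM2l.
have rateB i : nu' i 0 <= B /\ mu' i 0 <= B.
  have := nuc i; have := muc i; rewrite !ler_norml => /andP[_ h1] /andP[_ h2].
  have : nu i 0 + mu i 0 <= \sum_i (nu i 0 + mu i 0).
    by apply: (sum_ge_term (f := fun i => nu i 0 + mu i 0)) => k; rewrite addr_ge0.
  by have := nu0 i; have := mu0 i; rewrite /B; split; lra.
have sr0 : 0 < sigma * r by rewrite mulr_gt0.
have nf : near_fluid A nu mu kappa alpha C h e l U X Tc.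
  split=> //.
    move=> b K s' t' s'0 s't' t'U H.
    apply: (model_integrates model s'0 s't' t'U).
    by move=> u su ut; under eq_bigr do rewrite -Xcounts; exact: H.
  move=> s' t' i s'0 s't' t'U t's'.
  have t'0 : 0 <= t' by exact: le_trans s't'.
  have /andP[dT0 dT1] := dTc i s' t' s'0 s't'.
  have HE := regular_path (model_arrivals model i) (nu'0 i) sr0 s0 s1 (regE i)
    s'0 s't' _.
  have {}HE := HE (le_lt_trans (le_trans t'U (_ : U <= cap * U + U)) lU).
  have {}HE : `|(E i t' w)%:R - (E i s' w)%:R - nu' i 0 * (t' - s')|
      <= sigma * nu' i 0 * (t' - s') + 4 * nu' i 0 * (sigma * r).
    by apply: HE; rewrite lerDr mulr_ge0.
  have Tst : Tc i s' <= Tc i t' by rewrite -subr_ge0.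
  have HS := regular_path (model_services model i) (mu'0 i) sr0 s0 s1 (regS i)
    (Tc_ge0 i s' s'0) Tst (Tc_lt i t' t'0 t'U).
  have -> : X t' i 0 - X s' i 0 = ((E i t' w)%:R - (E i s' w)%:R -
      ((S i (Tc i t') w)%:R - (S i (Tc i s') w)%:R)) / l.
    rewrite !mxE (model_dynamics model i w t'0) (model_dynamics model i w s'0).
    by rewrite -/(Tc i t') -/(Tc i s'); ring.
  rewrite -mulrBl normrM normfV (gtr0_norm l0) ler_pdivrMr//.
  apply: (@le_trans _ _ (sigma * Q * l)); last by rewrite ler_wpM2r// ltW.
  have [nuB muB] := rateB i.
  by apply: (fluid_error (ltW s0) (ltW r0) rl _ t's' cap_ge0 dT0 dT1
    (ltW (nu'0 i)) nuB (ltW (mu'0 i)) muB (nuc i) (muc i) HE HS); rewrite subr_ge0.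
have scaled_lift t : is_lifting A nu mu kappa alpha (workload A mu' (X (r ^+ 2 * t)))
    (M^-1 *: lifting A nu mu kappa alpha (workload A mu' (diffusion r N t w))).
  rewrite XD workloadZ; apply: is_lifting_scale; rewrite ?invr_gt0//.
  exact: liftingP.
have coord t i : X (r ^+ 2 * t) i 0 -
    (M^-1 *: lifting A nu mu kappa alpha (workload A mu' (diffusion r N t w))) i 0 =
    M^-1 * (diffusion r N t w - lifting A nu mu kappa alpha
     (workload A mu' (diffusion r N t w))) i 0.
  by rewrite XD !mxE -mulrBr.
have gap0 : gap A nu mu kappa alpha (X 0) <= eg / 2.
  have lift0 := scaled_lift 0; have coord0 := coord 0.
  rewrite !mulr0 in lift0 coord0.
  apply: (Hi _ _ _ (XB 0 (lexx _) U0) lift0) => [j|i].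
    by apply: le_trans sei; apply: workload_close => //; exact: XB.
  rewrite coord0 normrM normfV (gtr0_norm M0) ler_pdivrMl//.
  by apply: le_trans (init i) _; rewrite ler_peMl// ltW.
have gapt := He _ _ _ _ l0 nf gap0.
move=> t t0 tT i.
have t'0 : 0 <= r ^+ 2 * t by rewrite mulr_ge0// ltW.
have t'U : r ^+ 2 * t <= U by rewrite ler_pM2l.
have XBt := XB _ t'0 t'U.
have wclose j : `|workload A mu' (X (r ^+ 2 * t)) j 0 -
    limit_workload A mu (X (r ^+ 2 * t)) j 0| <= eg.
  by apply: le_trans seg; exact: workload_close.
have := Hg _ _ _ XBt (scaled_lift t) wclose (gapt _ t'0 t'U) i.
by rewrite coord normrM normfV (gtr0_norm M0) ler_pdivrMl// [M * _]mulrC.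
Qed.

End OneSystem.

(** * Limits along the sequence of systems *)

Section Norm.
Context {R : realType} {n : nat}.
Local Open Scope classical_set_scope.
Local Open Scope ring_scope.
Implicit Types (v : 'cV[R]_n).

Lemma enorm_ge0 v : 0 <= enorm v. Proof. exact: sqrtr_ge0. Qed.

Lemma coord_le_enorm v i : `|v i 0| <= enorm v.
Proof.
rewrite /enorm -sqrtr_sqr ler_sqrt; last by apply: sumr_ge0 => k _; exact: sqr_ge0.
by apply: (sum_ge_term (f := fun i => v i 0 ^+ 2)) => k; exact: sqr_ge0.
Qed.

Lemma enorm_le (c : R) v : (forall i, `|v i 0| <= c) -> enorm v <= n%:R * c.
Proof.
move=> vc; have [c0|c0] := leP 0 c; last first.
  have noi (i : 'I_n) : False by have := le_trans (normr_ge0 _) (vc i); rewrite leNgt c0.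
  rewrite /enorm big1 ?sqrtr0 => [|i _]; last by case: (noi i).
  move: v vc noi; case: n => [|m] v vc noi; first by rewrite mul0r.
  by case: (noi ord0).
rewrite -[leRHS]ger0_norm ?mulr_ge0// -sqrtr_sqr ler_sqrt ?sqr_ge0//.
have -> : (n%:R * c) ^+ 2 = (n%:R * c) * (n%:R * c) by rewrite expr2.
apply: (@le_trans _ _ (\sum_(i < n) c * (n%:R * c))); last first.
  by rewrite -mulr_suml sumr_const card_ord mulr_natl.
apply: ler_sum => i _; rewrite -[v i 0 ^+ 2]ger0_norm ?sqr_ge0// normrX expr2.
apply: ler_pM => //; apply: le_trans (vc i) _.
rewrite ler_peMl// ler1n; exact: leq_ltn_trans (ltn_ord i).
Qed.

Lemma cvg_coord_near (v_ : nat -> 'cV[R]_n) v (e : R) :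
  v_ k @[k --> \oo] --> v -> 0 < e ->
  \forall k \near \oo, forall i, `|v_ k i 0 - v i 0| <= e.
Proof.
move=> vv e0; apply: filter_forall => i.
have /cvgrPdist_le/(_ e e0) : v_ k i 0 @[k --> \oo] --> v i 0.
  exact: (cvg_comp _ _ vv (@coord_continuous _ _ _ i 0 v)).
by apply: filterS => k; rewrite distrC.
Qed.

Lemma cvg_coord_inv_near (v_ : nat -> 'cV[R]_n) v (e : R) :
  v_ k @[k --> \oo] --> v -> (forall i, v i 0 != 0) -> 0 < e ->
  \forall k \near \oo, forall i, `|(v_ k i 0)^-1 - (v i 0)^-1| <= e.
Proof.
move=> vv v0 e0; apply: filter_forall => i.
have vi : v_ k i 0 @[k --> \oo] --> v i 0.
  exact: (cvg_comp _ _ vv (@coord_continuous _ _ _ i 0 v)).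
have /cvgrPdist_le/(_ e e0) : (v_ k i 0)^-1 @[k --> \oo] --> (v i 0)^-1.
  by apply: cvgV.
by apply: filterS => k; rewrite distrC.
Qed.

End Norm.

Section HeavyTraffic.
Context {R : realType} {nJ nI : nat}.
Local Open Scope classical_set_scope.
Local Open Scope ring_scope.

(** A sequence that stays bounded after multiplication by [r], which tends to
    infinity, tends to zero. *)
Lemma heavy_traffic_limit (A : 'M[R]_(nJ, nI)) (C theta : 'cV[R]_nJ) (r : nat -> R)
    (nu_ mu_ : nat -> 'cV[R]_nI) (nu mu : 'cV[R]_nI) j :
  r k @[k --> \oo] --> +oo ->
  nu_ k @[k --> \oo] --> nu -> mu_ k @[k --> \oo] --> mu -> (forall i, 0 < mu i 0) ->
  r k *: (A *m (\col_i (nu_ k i 0 / mu_ k i 0)) - C) @[k --> \oo] --> theta ->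
  \sum_i A j i * (nu i 0 / mu i 0) = C j 0.
Proof.
move=> r_infty nu_cvg mu_cvg mu0 heavy.
pose u k := \sum_i A j i * (nu_ k i 0 / mu_ k i 0) - C j 0.
have coord n (v_ : nat -> 'cV[R]_n) (v : 'cV[R]_n) i :
    v_ k @[k --> \oo] --> v -> v_ k i 0 @[k --> \oo] --> v i 0.
  by move=> vv; exact: (cvg_comp _ _ vv (@coord_continuous _ _ _ i 0 v)).
have u1 : u k @[k --> \oo] --> \sum_i A j i * (nu i 0 / mu i 0) - C j 0.
  apply: cvgB; last exact: cvg_cst.
  apply: (@cvg_big _ _ _ _ _ add_continuous _ \oo) => i _.
  apply: cvgM; first exact: cvg_cst.
  apply: cvgM; first exact: coord.
  by apply: cvgV; [rewrite gt_eqF | exact: coord].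
have r0 : \forall k \near \oo, 0 < r k by move/cvgryPgt: r_infty; exact.
have rV : (r k)^-1 @[k --> \oo] --> 0 by apply/gtr0_cvgV0.
have u2 : u k @[k --> \oo] --> 0.
  have : (r k)^-1 * (r k * u k) @[k --> \oo] --> 0 * theta j 0.
    apply: cvgM => //; have := coord _ _ _ j heavy; apply: cvg_trans.
    apply: near_eq_cvg; apply: nearW => k; rewrite !mxE /u; congr (_ * (_ - _)).
    by apply: eq_bigr => i _; rewrite mxE.
  rewrite mul0r; apply: cvg_trans; apply: near_eq_cvg.
  by apply: filterS r0 => k rk; rewrite mulrA mulVf ?mul1r// gt_eqF.
apply/eqP; rewrite -subr_eq0; apply/eqP.
by apply: norm_cvg_unique u1 u2.
Qed.

End HeavyTraffic.

Section Estimates.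
Context {R : realType}.
Local Open Scope classical_set_scope.
Local Open Scope ring_scope.

Lemma measure_finite_union_le d (T : measurableType d) (P : probability T R)
    (I : finType) (F : I -> set T) (c : R) :
  (forall i, measurable (F i)) -> (forall i, (P (F i) <= c%:E)%E) ->
  measurable (\bigcup_i F i) /\ (P (\bigcup_i F i) <= (#|I|%:R * c)%:E)%E.
Proof.
move=> mF Fc.
have h (s : seq I) : measurable (\big[setU/set0]_(i <- s) F i) /\
    (P (\big[setU/set0]_(i <- s) F i) <= ((size s)%:R * c)%:E)%E.
  elim: s => [|i s [ih1 ih2]]; first by rewrite big_nil measure0 mul0r.
  rewrite big_cons; split; first exact: measurableU.
  apply: le_trans (measureU2 _ _ _) _ => //.
  by rewrite /= -natr1 mulrDl mul1r addrC EFinD; exact: leeD.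
have -> : \bigcup_i F i = \big[setU/set0]_(i <- enum I) F i.
  rewrite -bigcup_seq (_ : [set` enum I] = setT)//.
  by apply/seteqP; split=> i //= _; rewrite mem_enum.
by have := h (enum I); rewrite -cardE.
Qed.

(** Exponential decay beats the linear growth of the number of mesh points. *)
Lemma expR_decay (c D x : R) : 0 < c -> 0 <= D -> 1 <= x ->
  (D * x + 1) * expR (- (c * x)) <= (D + 1) * 2 / c ^+ 2 * x^-1.
Proof.
move=> c0 D0 x1; have x0 : 0 < x by lra.
have cx0 : 0 < c * x by rewrite mulr_gt0.
have := @expR_ge1Dxn R (c * x) 1 (ltW cx0); rewrite (_ : 2`!%:R = 2)// => h.
have h2 : (c * x) ^+ 2 / 2 <= expR (c * x) by lra.
have q0 : 0 < (c * x) ^+ 2 / 2 by rewrite divr_gt0// exprn_gt0.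
have -> : (D + 1) * 2 / c ^+ 2 * x^-1 = ((D + 1) * x) * ((c * x) ^+ 2 / 2)^-1.
  by field; rewrite !gt_eqF.
apply: ler_pM.
- by rewrite addr_ge0// mulr_ge0// ltW.
- exact: expR_ge0.
- by rewrite mulrDl mul1r lerD2l.
- by rewrite expRN lef_pV2 ?posrE// expR_gt0.
Qed.

Lemma irregular_mesh_le (lam lam0 sigma r D : R) (n : nat) :
  0 < lam0 -> lam0 <= lam -> 0 < sigma -> 1 <= r -> 0 <= D -> n%:R <= D * r + 1 ->
  n%:R * (2 * expR (- (lam * (sigma * r) * sigma ^+ 2 / 8))) <=
  4 * (D + 1) / (lam0 * sigma ^+ 3 / 8) ^+ 2 * r^-1.
Proof.
move=> l0 ll s0 r1 D0 nD; set c := lam0 * sigma ^+ 3 / 8.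
have c0 : 0 < c by rewrite divr_gt0 ?mulr_gt0 ?exprn_gt0.
have r0 : 0 < r by lra.
have E : expR (- (lam * (sigma * r) * sigma ^+ 2 / 8)) <= expR (- (c * r)).
  rewrite ler_expR lerN2 /c.
  have -> : lam0 * sigma ^+ 3 / 8 * r = lam0 * (sigma * r * sigma ^+ 2 / 8) by ring.
  have -> : lam * (sigma * r) * sigma ^+ 2 / 8 = lam * (sigma * r * sigma ^+ 2 / 8) by ring.
  by rewrite ler_wpM2r// divr_ge0// !mulr_ge0 ?exprn_ge0 ?(ltW s0) ?(ltW r0).
have := expR_decay c0 D0 r1.
have : n%:R * expR (- (lam * (sigma * r) * sigma ^+ 2 / 8)) <= (D * r + 1) * expR (- (c * r)).
  by apply: ler_pM => //; exact: expR_ge0.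
have -> : 4 * (D + 1) / c ^+ 2 * r^-1 = 2 * ((D + 1) * 2 / c ^+ 2 * r^-1) by ring.
lra.
Qed.

End Estimates.

(** * Multiplicative state space collapse *)

Section Collapse.
Context {R : realType} {nJ nI : nat}.
Local Open Scope classical_set_scope.
Local Open Scope ring_scope.
Context (A : 'M[R]_(nJ, nI)) (nu mu kappa : 'cV[R]_nI) (alpha : R).
Context (A01 : forall j i, A j i = 0 \/ A j i = 1).
Context (Arow : forall j, exists i, A j i = 1).
Context (nu_gt0 : forall i, 0 < nu i 0) (mu_gt0 : forall i, 0 < mu i 0).
Context (kappa_gt0 : forall i, 0 < kappa i 0) (alpha_gt0 : 0 < alpha).
Context (C : 'cV[R]_nJ) (Acol : forall i, exists j, A j i = 1).
Context (heavy : forall j, \sum_i A j i * (nu i 0 / mu i 0) = C j 0).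
Context (nI_gt0 : (0 < nI)%N).

Definition distance_to_manifold {d} {Omega : measurableType d}
    (mu' : 'cV[R]_nI) (r : R) (N : 'I_nI -> R -> Omega -> nat) t w : R :=
  enorm (diffusion r N t w -
    lifting A nu mu kappa alpha (workload A mu' (diffusion r N t w))).

Definition collapse_ratio {d} {Omega : measurableType d}
    (mu' : 'cV[R]_nI) (r : R) (N : 'I_nI -> R -> Omega -> nat) (T : R) w : R :=
  sup [set distance_to_manifold mu' r N t w | t in `[0, T]] /
  Num.max (sup [set enorm (diffusion r N t w) | t in `[0, T]]) 1.

Let cap := \sum_j C j 0.

Let cap_ge0 : 0 <= cap.
Proof. exact: (capacity_sum_ge0 A01 nu_gt0 mu_gt0 heavy). Qed.

Section Measurability.
Context {d : measure_display} {Omega : measurableType d} (P : probability Omega R).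
Context (nu' mu' : 'cV[R]_nI) (E S N : 'I_nI -> R -> Omega -> nat) (r T : R).
Context (model : flow_level_model P A C kappa alpha nu' mu' E S N).
Context (r_gt0 : 0 < r) (T_ge0 : 0 <= T).

Let x (v : {ffun 'I_nI -> nat}) : 'cV[R]_nI := r^-1 *: \col_i (v i)%:R.

Let diffusionE t w : diffusion r N t w = x (path_state N (r ^+ 2 * t) w).
Proof.
by rewrite /diffusion /x; congr (_ *: _); apply/matrixP => i j; rewrite !mxE ffunE.
Qed.

Let r2_gt0 : 0 < r ^+ 2. Proof. by rewrite exprn_gt0. Qed.

Let rescale (f : {ffun 'I_nI -> nat} -> R) w :
  [set f (path_state N (r ^+ 2 * t) w) | t in `[0, T]] =
  [set f (path_state N s w) | s in `[0, r ^+ 2 * T]].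
Proof.
apply/seteqP; split=> _ [t /= + <-]; rewrite in_itv/= => /andP[t0 tT].
  by exists (r ^+ 2 * t); rewrite //= in_itv/= ler_pM2l// tT mulr_ge0// ltW.
exists (t / r ^+ 2); last by rewrite mulrC divfK// gt_eqF.
by rewrite /= in_itv/= divr_ge0 ?(ltW r2_gt0)//= ler_pdivrMr// mulrC.
Qed.

Let fiber := model_fiber model.
Let right := model_right_constant A01 nu_gt0 mu_gt0 kappa_gt0 alpha_gt0 Acol heavy model.
Let bounded := model_bounded model.

Lemma distance_measurable (e : R) : measurable [set w | e <= `|distance_to_manifold mu' r N 0 w|].
Proof.
pose f v := enorm (x v - lifting A nu mu kappa alpha (workload A mu' (x v))).
have mf v := path_state_fiber fiber v (lexx (0 : R)).
have -> : [set w | e <= `|distance_to_manifold mu' r N 0 w|] =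
    path_state N 0 @^-1` [set v | e <= `|f v|].
  by apply/seteqP; split=> w; rewrite /= /distance_to_manifold diffusionE mulr0.
exact: fiber_measurable mf _.
Qed.

Lemma collapse_ratio_measurable (e : R) :
  measurable [set w | e <= `|collapse_ratio mu' r N T w|].
Proof.
pose f v := enorm (x v - lifting A nu mu kappa alpha (workload A mu' (x v))).
have U0 : 0 <= r ^+ 2 * T by rewrite mulr_ge0// ltW.
have m1 := running_sup_measurable fiber right bounded f U0.
have m2 := running_sup_measurable fiber right bounded (fun v => enorm (x v)) U0.
pose s1 w := sup [set f (path_state N t w) | t in `[0, r ^+ 2 * T]].
pose s2 w := sup [set enorm (x (path_state N t w)) | t in `[0, r ^+ 2 * T]].
have E1 w : collapse_ratio mu' r N T w = s1 w / Num.max (s2 w) 1.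
  rewrite /s1 /s2 -(rescale f) -(rescale (fun v => enorm (x v))).
  have -> : [set f (path_state N (r ^+ 2 * t) w) | t in `[0, T]] =
      [set distance_to_manifold mu' r N t w | t in `[0, T]].
    by apply: eq_imagel => t _; rewrite /distance_to_manifold diffusionE.
  have -> : [set enorm (x (path_state N (r ^+ 2 * t) w)) | t in `[0, T]] =
      [set enorm (diffusion r N t w) | t in `[0, T]].
    by apply: eq_imagel => t _; rewrite diffusionE.
  by [].
have s10 w : 0 <= s1 w.
  apply: (@le_trans _ _ (f (path_state N 0 w))); first exact: enorm_ge0.
  have [M HM] := path_values_bounded bounded f (r ^+ 2 * T) w.
  apply: ub_le_sup.
    by exists M => _ [s /= + <-]; rewrite in_itv/= => /andP[]; exact: HM.
  by exists 0 => //=; rewrite in_itv/= lexx.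
have max0 w : 0 < Num.max (s2 w) 1 by rewrite lt_max ltr01 orbT.
have -> : [set w | e <= `|collapse_ratio mu' r N T w|] =
    (fun w => s1 w - e * Num.max (s2 w) 1) @^-1` `[0, +oo[.
  apply/seteqP; split=> w /=; rewrite in_itv/= andbT E1 ger0_norm ?divr_ge0 ?(ltW (max0 w))//;
    by rewrite ler_pdivlMr// subr_ge0.
rewrite -[X in measurable X]setTI; apply: measurable_funB => //.
apply: measurable_funM => //.
exact: measurable_maxr.
Qed.

Lemma diffusion_has_ubound w :
  has_ubound [set enorm (diffusion r N t w) | t in `[0, T]].
Proof.
have [M HM] := path_values_bounded bounded (fun v => enorm (x v)) (r ^+ 2 * T) w.
exists M => _ [t /= + <-]; rewrite in_itv/= => /andP[t0 tT].
by rewrite diffusionE; apply: HM; [rewrite mulr_ge0// ltW | rewrite ler_pM2l].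
Qed.

End Measurability.

(** The constants are uniform over all systems whose rates are close to the limit.
    The union bound runs over about [r] mesh points per process, each of
    exponentially small probability in [r]. *)
Lemma collapse_probability (eps T : R) : 0 < eps -> 0 < T ->
  exists sigma ei K : R, [/\ 0 < sigma, 0 < ei &
  forall (d : measure_display) (Omega : measurableType d) (P : probability Omega R)
    (nu' mu' : 'cV[R]_nI) (E S N : 'I_nI -> R -> Omega -> nat) (r : R),
  flow_level_model P A C kappa alpha nu' mu' E S N -> 1 <= r ->
  (forall i, 0 < nu' i 0) -> (forall i, 0 < mu' i 0) ->
  (forall i, `|nu' i 0 - nu i 0| <= sigma) ->
  (forall i, `|mu' i 0 - mu i 0| <= sigma) ->
  (forall i, `|(mu' i 0)^-1 - (mu i 0)^-1| <= sigma) ->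
  (P [set w | (eps <= `|collapse_ratio mu' r N T w|)%R] <=
   P [set w | (ei <= `|distance_to_manifold mu' r N 0 w|)%R] + (K * r^-1)%:E)%E].
Proof.
move=> eps0 T0; have nI0 : 0 < nI%:R :> R by rewrite ltr0n.
have dist0 : 0 < eps / (2 * nI%:R) by rewrite divr_gt0 ?mulr_gt0.
have [s1 [ei [s10 s11 ei0 Hpath]]] := collapse_on_regular_paths A01 Arow nu_gt0 mu_gt0
  kappa_gt0 alpha_gt0 Acol heavy dist0.
have [ln ln0 Hln] := finite_lower_bound nu_gt0.
have [lm lm0 Hlm] := finite_lower_bound mu_gt0.
pose lam0 := Num.min ln lm / 2.
have lam00 : 0 < lam0 by rewrite divr_gt0// lt_min ln0 lm0.
pose D := (1 + cap) * T / s1.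
have D0 : 0 <= D by rewrite divr_ge0 ?(ltW s10)// mulr_ge0 ?(ltW T0)// addr_ge0.
pose K := 4 * (D + 1) / (lam0 * s1 ^+ 3 / 8) ^+ 2.
exists (Num.min s1 lam0), ei, (#|{: 'I_nI + 'I_nI}|%:R * K).
split=> //; first by rewrite lt_min s10.
move=> d Omega P nu' mu' E S N r model r1 nu'0 mu'0 nuc muc invc.
have r0 : 0 < r by lra.
have min_s1 : Num.min s1 lam0 <= s1 by rewrite ge_min lexx.
have min_l : Num.min s1 lam0 <= lam0 by rewrite ge_min lexx orbT.
have lam_nu i : lam0 <= nu' i 0.
  have := nuc i; rewrite ler_norml => /andP[h _].
  have h2 : Num.min ln lm <= nu i 0 by apply: le_trans (Hln i); rewrite ge_min lexx.
  move: h h2 min_l; rewrite /lam0; lra.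
have lam_mu i : lam0 <= mu' i 0.
  have := muc i; rewrite ler_norml => /andP[h _].
  have h2 : Num.min ln lm <= mu i 0 by apply: le_trans (Hlm i); rewrite ge_min lexx orbT.
  move: h h2 min_l; rewrite /lam0; lra.
pose n := (Num.truncn (D * r)).+1.
have /andP[nD1 nD2] := truncn_itv (mulr_ge0 D0 (ltW r0)).
have nD : n%:R <= D * r + 1 by rewrite /n -natr1 lerD2r.
have hor : (1 + cap) * (r ^+ 2 * T) < s1 * r * n%:R.
  have -> : (1 + cap) * (r ^+ 2 * T) = s1 * r * (D * r).
    by rewrite /D; field; rewrite gt_eqF.
  by rewrite ltr_pM2l ?mulr_gt0.
have a0 : 0 < s1 * r by rewrite mulr_gt0.
pose F (x : 'I_nI + 'I_nI) : set Omega := match x with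
  | inl i => irregular (nu' i 0) (s1 * r) s1 n (E i)
  | inr i => irregular (mu' i 0) (s1 * r) s1 n (S i) end.
have mF x : measurable (F x).
  case: x => i /=; apply: irregular_measurable (ltW a0);
    [exact: model_arrivals model i | exact: model_services model i].
have PF x : (P (F x) <= (K * r^-1)%:E)%E.
  case: x => i.
    apply: le_trans (irregular_le n (model_arrivals model i) (nu'0 i) a0 s10 s11) _.
    by rewrite lee_fin; exact: irregular_mesh_le.
  apply: le_trans (irregular_le n (model_services model i) (mu'0 i) a0 s10 s11) _.
  by rewrite lee_fin; exact: irregular_mesh_le.
have [mU PU] := measure_finite_union_le mF PF.
have mI := distance_measurable r model ei.
apply: (@le_trans _ _ (P ([set w | ei <= `|distance_to_manifold mu' r N 0 w|] `|`
  \bigcup_x F x))).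
  apply: le_measure; rewrite ?inE.
  - exact: (collapse_ratio_measurable model r0 (ltW T0)).
  - exact: measurableU.
  move=> w /= epsw; apply: contrapT => /not_orP[noI noF].
  set M := Num.max (sup [set enorm (diffusion r N t w) | t in `[0, T]]) 1.
  have M1 : 1 <= M by rewrite le_max lexx orbT.
  have M0 : 0 < M by exact: lt_le_trans M1.
  have Mb t : 0 <= t -> t <= T -> forall i, diffusion r N t w i 0 <= M.
    move=> t0 tT i; apply: le_trans (ler_norm _) _.
    apply: le_trans (coord_le_enorm _ _) _; rewrite le_max; apply/orP; left.
    apply: ub_le_sup; first exact: (diffusion_has_ubound _ model r0).
    by exists t; rewrite //= in_itv/= t0.
  have regE i : ~ irregular (nu' i 0) (s1 * r) s1 n (E i) w.
    by move=> H; apply: noF; exists (inl i).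
  have regS i : ~ irregular (mu' i 0) (s1 * r) s1 n (S i) w.
    by move=> H; apply: noF; exists (inr i).
  have init i : `|(diffusion r N 0 w - lifting A nu mu kappa alpha
      (workload A mu' (diffusion r N 0 w))) i 0| <= ei.
    apply: le_trans (coord_le_enorm _ _) _.
    by move/negP: noI; rewrite -ltNge ger0_norm ?enorm_ge0// => /ltW.
  have close t : 0 <= t -> t <= T -> distance_to_manifold mu' r N t w <= eps / 2 * M.
    move=> t0 tT; have -> : eps / 2 * M = nI%:R * (eps / (2 * nI%:R) * M).
      by field; rewrite gt_eqF.
    apply: enorm_le => i.
    exact: (Hpath _ _ _ _ _ _ _ _ _ _ _ _ model r0 T0 nu'0 mu'0
      (fun i => le_trans (nuc i) min_s1) (fun i => le_trans (muc i) min_s1)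
      (fun i => le_trans (invc i) min_s1) hor regE regS init M M1 Mb t t0 tT i).
  have ub : ubound [set distance_to_manifold mu' r N t w | t in `[0, T]] (eps / 2 * M).
    by move=> _ [t /= + <-]; rewrite in_itv/= => /andP[]; exact: close.
  have in0 : [set distance_to_manifold mu' r N t w | t in `[0, T]]
      (distance_to_manifold mu' r N 0 w).
    by exists 0; rewrite //= in_itv/= lexx ltW.
  have sup0 : 0 <= sup [set distance_to_manifold mu' r N t w | t in `[0, T]].
    apply: le_trans (enorm_ge0 _) (ub_le_sup _ in0).
    by exists (eps / 2 * M).
  have supM : sup [set distance_to_manifold mu' r N t w | t in `[0, T]] <= eps / 2 * M.
    by apply: ge_sup => //; exists (distance_to_manifold mu' r N 0 w).
  move: epsw; rewrite /collapse_ratio -/M ger0_norm ?divr_ge0 ?(ltW M0)//.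
  apply/negP; rewrite -ltNge ltr_pdivrMr//; apply: le_lt_trans supM _.
  by rewrite ltr_pM2r//; lra.
apply: le_trans (measureU2 _ mI mU) _; apply: leeD => //.
by rewrite -mulrA.
Qed.

End Collapse.

Theorem theorem5p1 (R : realType) (nJ nI : nat)
  (nJ_gt0 : (0 < nJ)%N) (nI_gt0 : (0 < nI)%N)
  (route : 'I_nI -> {set 'I_nJ}) (route_nonempty : forall i, (0 < #|route i|)%N)
  (A : 'M[R]_(nJ, nI)) (A_def : A = incidence route) (A_rank : \rank A = nJ)
  (C : 'cV[R]_nJ) (C_gt0 : forall j, 0 < C j 0)
  (kappa : 'cV[R]_nI) (kappa_gt0 : forall i, 0 < kappa i 0)
  (alpha : R) (alpha_gt0 : 0 < alpha)
  (r : nat -> R) (r_gt0 : forall k, 0 < r k) (r_incr : increasing_seq r)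
  (r_infty : r k @[k --> \oo] --> +oo)
  (nu_ mu_ : nat -> 'cV[R]_nI)
  (nu__gt0 : forall k i, 0 < nu_ k i 0) (mu__gt0 : forall k i, 0 < mu_ k i 0)
  (d : nat -> measure_display) (Omega : forall k, measurableType (d k))
  (P : forall k, probability (Omega k) R)
  (E S N : forall k, 'I_nI -> R -> Omega k -> nat)
  (model : forall k,
     flow_level_model (P k) A C kappa alpha (nu_ k) (mu_ k) (E k) (S k) (N k))
  (nu mu : 'cV[R]_nI) (theta : 'cV[R]_nJ)
  (nu_gt0 : forall i, 0 < nu i 0) (mu_gt0 : forall i, 0 < mu i 0)
  (nu_cvg : nu_ k @[k --> \oo] --> nu) (mu_cvg : mu_ k @[k --> \oo] --> mu)
  (heavy_traffic :
     r k *: (A *m (\col_i (nu_ k i 0 / mu_ k i 0)) - C) @[k --> \oo] --> theta)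
  (d' : measure_display) (Omega' : measurableType d')
  (P' : probability Omega' R) (W0 : Omega' -> 'cV[R]_nJ)
  (W0_measurable : forall j, measurable_fun setT (fun w => W0 w j 0))
  (Nhat := fun k t w => diffusion (r k) (N k) t w)
  (What := fun k t w => workload A (mu_ k) (Nhat k t w))
  (Delta := lifting A nu mu kappa alpha)
  (initial_workload : cvg_in_distribution P (fun k => What k 0) P' W0) :
  cvg_to0_in_probability P
    (fun k w => enorm (Nhat k 0 w - Delta (What k 0 w))) ->
  forall T : R, 0 < T ->
    cvg_to0_in_probability P (fun k w =>
      sup [set enorm (Nhat k t w - Delta (What k t w)) | t in `[0, T]] /
      Num.max (sup [set enorm (Nhat k t w) | t in `[0, T]]) 1).
Proof.
move=> init T T0 eps eps0.
have A01 j i : A j i = 0 \/ A j i = 1.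
  by rewrite A_def mxE; case: (_ \in _); [right | left].
have Acol i : exists j, A j i = 1.
  by have /card_gt0P[j ij] := route_nonempty i; exists j; rewrite A_def mxE ij.
have heavy j : \sum_i A j i * (nu i 0 / mu i 0) = C j 0.
  exact: (heavy_traffic_limit j r_infty nu_cvg mu_cvg mu_gt0 heavy_traffic).
have Arow j : exists i, A j i = 1.
  have [//|none] := pselect (exists i, A j i = 1).
  have := C_gt0 j; rewrite -heavy big1 ?ltxx// => i _.
  by case: (A01 j i) => [->|Aji]; [rewrite mul0r | case: none; exists i].
have [sigma [ei [K [sigma0 ei0 HP]]]] := collapse_probability A01 Arow nu_gt0 mu_gt0
  kappa_gt0 alpha_gt0 Acol heavy nI_gt0 eps0 T0.
have K_cvg : (K * (r k)^-1)%:E @[k --> \oo] --> 0%E.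
  apply: cvg_EFin; first exact: nearW.
  rewrite -[X in _ --> X](mulr0 K); apply: cvgM; first exact: cvg_cst.
  by apply/gtr0_cvgV0 => //; exact: nearW.
have upper_cvg : (P k [set w | (ei <= `|enorm (Nhat k 0%R w - Delta (What k 0%R w))|)%R]%classic
    + (K * (r k)^-1)%R%:E)%E @[k --> \oo] --> 0%E.
  by rewrite -[X in _ --> X]adde0; apply: cvgeD => //; exact: init.
apply: (squeeze_cvge _ (cvg_cst 0%E) upper_cvg).
have r1 : \forall k \near \oo, 1 <= r k by move/cvgryPge: r_infty; exact.
have nuc := cvg_coord_near nu_cvg sigma0.
have muc := cvg_coord_near mu_cvg sigma0.
have invc := cvg_coord_inv_near mu_cvg (fun i => lt0r_neq0 (mu_gt0 i)) sigma0.
near=> k; rewrite measure_ge0/=.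
apply: (HP _ _ _ _ _ _ _ _ _ (model k)) => //; near: k.
Unshelve. all: by end_near.
Qed.
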